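(* Let $W$ be a standard Brownian motion with drift $\mu\in\mathbb{R}$, let $c>0$, and let $S$ be an exponential random variable with density $\nu e^{-\nu x}I_{\{x\ge0\}}$, $\nu>0$, independent of $W$. Then $$\mathbb{E}\,TV^c(W,S)=\frac{V_\mu(\nu)}{\nu}\cosh(c\mu)$$ and $$\mathbb{E}\,TV^c(W,S)^2=\frac{V_\mu(\nu)}{\nu^2}\left(V_\mu(\nu)+\cosh(\mu c)\,\theta_\mu(\nu)+e^{\mu c}\mu\right).$$
   Context: $W_t=B_t+\mu t$, $t\ge0$, with $B$ a standard Brownian motion. $TV^c(W,s)=\sup_n\sup_{0\le t_0<t_1<\dots<t_n\le s}\sum_{i=1}^n\max\{|W_{t_i}-W_{t_{i-1}}|-c,0\}$. Further, $\theta_\mu(\nu)=\sqrt{\mu^2+2\nu}\,\coth(c\sqrt{\mu^2+2\nu})-\mu$ and $V_\mu(\nu)=\dfrac{\sqrt{\mu^2+2\nu}}{\sinh(c\sqrt{\mu^2+2\nu})}$. *)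

(* Defs.v *)
From HB Require Import structures.
From mathcomp Require Import all_boot all_order all_algebra.
From mathcomp Require Import all_classical all_reals all_analysis.

Set Implicit Arguments.
Unset Strict Implicit.
Unset Printing Implicit Defensive.
Import Order.TTheory GRing.Theory Num.Theory.
Import numFieldNormedType.Exports.
Local Open Scope classical_set_scope.
Local Open Scope ring_scope.

Section hyperbolic.
Context {R : realType}.
Implicit Types x : R.

Definition cosh x : R := (expR x + expR (- x)) / 2.
Definition sinh x : R := (expR x - expR (- x)) / 2.
Definition coth x : R := cosh x / sinh x.

End hyperbolic.

Section theta_V.
Context {R : realType}.
Implicit Types c mu nu : R.

Definition theta c mu nu : R :=
  Num.sqrt (mu ^+ 2 + 2 * nu) * coth (c * Num.sqrt (mu ^+ 2 + 2 * nu)) - mu.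

Definition V c mu nu : R :=
  Num.sqrt (mu ^+ 2 + 2 * nu) / sinh (c * Num.sqrt (mu ^+ 2 + 2 * nu)).

End theta_V.

(* Partitions t 0 < ... < t n are encoded by total functions t : nat -> R, of
   which only the values up to n matter.  The partition with n = 0 contributes
   the empty sum, so TVc c f 0 = 0; for s < 0 there is no partition and the
   value is -oo. *)
Definition TVc {R : realType} (c : R) (f : R -> R) (s : R) : \bar R :=
  ereal_sup [set x : \bar R | exists (n : nat) (t : nat -> R),
    [/\ 0 <= t 0%N,
        forall i : nat, (i < n)%N -> t i < t i.+1,
        t n <= s
      & x = (\sum_(i < n) Num.max (`|f (t i.+1) - f (t i)| - c) 0)%:E]].

Section processes.
Context {d : measure_display} {T : measurableType d} {R : realType}.
Variable P : probability T R.

(* Taking A i = setT recovers the product rule for every subfamily. *)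
Definition mutually_independent (n : nat) (X : 'I_n -> T -> R) : Prop :=
  forall A : 'I_n -> set R, (forall i, measurable (A i)) ->
    P (\bigcap_i (X i @^-1` A i)) = (\prod_(i < n) P (X i @^-1` A i))%E.

(* Processes are indexed by R, but only the times t >= 0 are ever used. *)
Definition sigma_process (X : R -> T -> R) : set (set T) :=
  <<s \bigcup_(t in [set t | 0 <= t])
        preimage_set_system setT (X t) measurable >>.

Definition process_independent (X : R -> T -> R) (S : T -> R) : Prop :=
  forall E F : set T,
    sigma_process X E -> preimage_set_system setT S measurable F ->
    P (E `&` F) = (P E * P F)%E.

(* The second parameter of normal_prob is the standard deviation. *)
Record standard_brownian_motion (B : R -> {RV P >-> R}) : Prop := {
  bm_start : {ae P, forall w, B 0 w = 0} ;
  bm_independent_increments : forall (n : nat) (t : nat -> R),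
    0 <= t 0%N -> (forall i : nat, (i < n)%N -> t i < t i.+1) ->
    mutually_independent
      (fun (i : 'I_n) (w : T) => B (t i.+1) w - B (t i) w) ;
  bm_gaussian_increments : forall s t : R, 0 <= s -> s < t ->
    forall A : set R, measurable A ->
      P ((fun w => B t w - B s w) @^-1` A)
      = normal_prob 0 (Num.sqrt (t - s)) A ;
  bm_continuous_paths :
    {ae P, forall w, {within `[0, +oo[, continuous (fun t => B t w)}}
}.

Definition bm_with_drift (B : R -> {RV P >-> R}) (mu : R) : R -> T -> R :=
  fun t w => B t w + mu * t.

End processes.

(* Main.v *)
Require Import Defs.
From HB Require Import structures.
From mathcomp Require Import all_boot all_order all_algebra.
From mathcomp Require Import all_classical all_reals all_analysis.
From mathcomp Require Import measurable_realfun.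
From mathcomp Require Import ring lra.

Set Implicit Arguments.
Unset Strict Implicit.
Unset Printing Implicit Defensive.
Import Order.TTheory GRing.Theory Num.Theory.
Import numFieldNormedType.Exports.
Local Open Scope classical_set_scope.
Local Open Scope ring_scope.

(** Sample W at the multiples of a step h.  The truncated variation along the
    grid is the total pushing of two walks that are driven by the increments
    of W and kept inside [0, c]: a walk [a], started at 0, of which the pushes
    down at the level c are counted, and a walk [b], started at c, of which
    the pushes up at the level 0 are counted ([truncsum_le_walk],
    [walk_chain]).  On a continuous path these grid quantities converge to the
    truncated variation from below ([gridpush_le_TVc], [gridpush_cvg]).

    In continuous time the expected pushes up to an independent exponential
    time would be the solutions A and D of f'' / 2 + mu f' = nu f with
    A'(0) = 0, A'(c) = 1 and D'(0) = -1, D'(c) = 0, started from A(0) and D(c)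
    respectively.  The second moment is then
    2 (A(c) + D(c)) A(0) + 2 (A(0) + D(0)) D(c), because a push of [a] at c
    finds both walks at c and a push of [b] at 0 finds both at 0.  In terms of
    del = sqrt (mu^2 + 2 nu) these values are the two closed forms.

    The same computation can be made on the grid.  The solutions A and D
    are positive combinations of two exponentials, and these are exact
    eigenfunctions of the Gaussian step with eigenvalue e^(nu h)
    ([gstep_upvalue]).  The only error comes from replacing A and D outside
    [0, c] by their tangents.  By convexity it has a sign, and it is quadratic
    in the overshoot, hence at most a small multiple of the overshoot plus
    o(h) ([gstep_over_sqr]).  The expected discounted sum of all overshoots is
    bounded uniformly in h, since A + D decreases on average by at least the
    overshoot ([barrier_step]); so the total error vanishes as h tends to 0
    ([discounted_moments]).  Discounting by e^(- nu h) per step is the same as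
    stopping at the geometric number of grid steps completed before the
    exponential time ([rint_stopped_moment]), and Fatou's lemma passes to the
    limit ([integral_stopped_limit]). *)

(** * Exponential moments of the Gaussian law *)

Section gaussian_exponential_moment.
Context {R : realType}.
Local Notation leb := (@lebesgue_measure R).

Lemma ge0_integral_normal_prob (m s : R) (f : R -> \bar R) :
  measurable_fun [set: R] f -> (forall x, 0 <= f x)%E ->
  (\int[normal_prob m s]_x f x = \int[leb]_x (f x * (normal_pdf m s x)%:E))%E.
Proof.
move=> mf f0.
have dom : normal_prob m s `<< leb by exact: normal_prob_dominates.
rewrite -(Radon_Nikodym_SigmaFinite.change_of_variables dom)//.
have mrn : measurable_fun [set: R]
    (Radon_Nikodym_SigmaFinite.f (normal_prob m s) leb).
  exact: measurable_int (Radon_Nikodym_SigmaFinite.f_integrable dom).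
have mpdf : measurable_fun [set: R] (fun x => (normal_pdf m s x)%:E).
  by apply/measurable_EFinP; exact: measurable_normal_pdf.
apply: ae_eq_integral => //; [exact: emeasurable_funM..|].
apply: ae_eqe_mul2l; apply: integral_ae_eq => //.
- exact: Radon_Nikodym_SigmaFinite.f_integrable.
- by move=> E _ mE; rewrite -Radon_Nikodym_SigmaFinite.f_integral.
Qed.

(** Multiplying the centred Gaussian density by an exponential produces, up to
    a constant factor, another Gaussian density. *)
Lemma normal_prob_expR (s t : R) : s != 0 ->
  (\int[normal_prob 0 s]_x (expR (t * x))%:E
   = (expR (t ^+ 2 * s ^+ 2 / 2))%:E)%E.
Proof.
move=> s0; rewrite ge0_integral_normal_prob; last 2 first.
- by apply/measurable_EFinP; exact: measurableT_comp.
- by move=> x; rewrite lee_fin expR_ge0.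
under eq_integral => x _.
  have -> : ((expR (t * x))%:E * (normal_pdf 0 s x)%:E =
     (expR (t ^+ 2 * s ^+ 2 / 2))%:E * (normal_pdf (t * s ^+ 2) s x)%:E)%E.
    rewrite -!EFinM /normal_pdf (negbTE s0); congr (_%:E).
    rewrite mulrCA [RHS]mulrCA; congr (_ * _).
    rewrite /normal_fun -!expRD; congr expR.
    rewrite -mulr_natl; field.
    exact: s0.
  over.
rewrite ge0_integralZl//=.
- by rewrite integral_normal_pdf mule1.
- by apply/measurable_EFinP; exact: measurable_normal_pdf.
- by move=> x _; rewrite lee_fin normal_pdf_ge0.
Qed.

End gaussian_exponential_moment.

(** * Reflection at the ends of an interval *)

Section overshoot.
Context {R : realType}.
Implicit Types c x y o u : R.

Definition clip c y : R := Num.max 0 (Num.min y c).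
Definition up c y : R := Num.max (y - c) 0.
Definition down y : R := Num.max (- y) 0.
Definition over c y : R := up c y + down y.

(** Case analysis on the position of [y] with respect to the interval. *)
Variant overshoot_spec c y : R -> R -> R -> Type :=
| OvershootMid of 0 <= y & y <= c : overshoot_spec c y y 0 0
| OvershootUp of c < y : overshoot_spec c y c (y - c) 0
| OvershootDown of y < 0 : overshoot_spec c y 0 0 (- y).

Lemma overshootP c y : 0 < c -> overshoot_spec c y (clip c y) (up c y) (down y).
Proof.
move=> c0; rewrite /clip /up /down.
have [yc|cy] := leP y c; have [y0|y0] := leP 0 y.
- by rewrite max_r ?subr_le0// max_r ?oppr_le0//; exact: OvershootMid.
- rewrite max_r ?subr_le0// max_l ?oppr_ge0 ?ltW//.
  exact: OvershootDown.
- rewrite max_r ?ltW// max_l ?subr_ge0 ?ltW// max_r ?oppr_le0//.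
  exact: OvershootUp.
- by move: (lt_trans c0 cy); rewrite ltNge (ltW y0).
Qed.

Lemma up_ge0 c y : 0 <= up c y.
Proof. by rewrite /up le_max lexx orbT. Qed.

Lemma down_ge0 y : 0 <= down y.
Proof. by rewrite /down le_max lexx orbT. Qed.

Lemma over_ge0 c y : 0 <= over c y.
Proof. by rewrite addr_ge0 ?up_ge0 ?down_ge0. Qed.

Lemma clip_ge0 c y : 0 <= clip c y.
Proof. by rewrite /clip le_max lexx. Qed.

Lemma clip_le c y : 0 < c -> clip c y <= c.
Proof. by move=> c0; case: overshootP => // _; exact: ltW. Qed.

Lemma clip_homo c : {homo clip c : x y / x <= y}.
Proof.
move=> x y xy; rewrite /clip ge_max !le_max lexx/=.
by apply/orP; right; rewrite le_min !ge_min lexx xy orbT.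
Qed.

Lemma over_le c y x : 0 < c -> 0 <= y -> y <= c -> over c (y + x) <= `|x|.
Proof.
move=> c0 y0 yc; have := ler_norm x; have := ler_norm (- x); rewrite normrN.
by rewrite /over; case: overshootP => //; lra.
Qed.

(* Reflecting the interval exchanges the two ends. *)
Lemma clip_sym c y : 0 < c -> clip c (c - y) = c - clip c y.
Proof. by move=> c0; do 2 (case: overshootP => //); lra. Qed.

Lemma up_sym c y : up c (c - y) = down y.
Proof. by rewrite /up /down addrAC subrr add0r. Qed.

Lemma down_sym c y : down (c - y) = up c y.
Proof. by rewrite /up /down opprB. Qed.

End overshoot.

Section exponential_bounds.
Context {R : realType}.
Implicit Types u x o : R.

Lemma expR_le_sqr u : expR u <= 1 + u + u ^+ 2 * expR `|u|.
Proof.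
have h1 : expR u <= 1 + u * expR u.
  have := expR_ge1Dx (- u); have := expRxMexpNx_1 u; have := expR_gt0 u.
  by nra.
have [u0|u0] := leP 0 u; first by rewrite ger0_norm//; nra.
rewrite ltr0_norm//; have := expR_ge1Dx (- u); have := expR_gt0 (- u).
have := expR_ge1Dx u; have := expR_gt0 u; nra.
Qed.

(** An even combination of exponentials that vanishes to fourth order at the
    origin, so that its mean under a Gaussian step is quadratic in the length
    of the step. *)
Definition quartic (t x : R) : R := (expR (t * x) - expR (- (t * x))) ^+ 4.

Lemma quarticE t x : quartic t x + 4 * (expR (2 * t * x) + expR (- 2 * t * x))
  = expR (4 * t * x) + expR (- 4 * t * x) + 6.
Proof.
rewrite /quartic; set e := expR (t * x).
have e1 : expR (- (t * x)) = e^-1 by rewrite expRN.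
have -> : expR (2 * t * x) = e ^+ 2 by rewrite -expRM_natl mulrA.
have -> : expR (4 * t * x) = e ^+ 4 by rewrite -expRM_natl mulrA.
have -> : expR (- 2 * t * x) = e ^- 2.
  by rewrite -expRM_natl -expRN; congr expR; ring.
have -> : expR (- 4 * t * x) = e ^- 4.
  by rewrite -expRM_natl -expRN; congr expR; ring.
by rewrite e1; field; rewrite gt_eqF// expR_gt0.
Qed.

Lemma quartic_ge0 t x : 0 <= quartic t x.
Proof. by rewrite /quartic exprn_even_ge0. Qed.

Lemma quartic_norm t x : quartic t x = quartic t `|x|.
Proof.
have [x0|x0] := leP 0 x; first by rewrite ger0_norm.
by rewrite ltr0_norm// /quartic mulrN opprK; ring.
Qed.

(** Small overshoots are absorbed by the linear term, large steps by the
    quartic one. *)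
Lemma overshoot_sqr (K e : R) : 0 <= K -> 0 < e ->
  exists2 C : R, 0 <= C & forall o x, 0 <= o -> o <= `|x| ->
    o ^+ 2 * expR (K * o) <= e * o + C * quartic (K + 1) x.
Proof.
(* Steps of size at most r are small, also after the factor expR (K * o). *)
move=> K0 e0; pose r := Num.min 1 (e * expR (- K)).
have r0 : 0 < r by rewrite lt_min ltr01 mulr_gt0// expR_gt0.
exists ((1 + r^-1) ^+ 4); first by rewrite exprn_ge0// addr_ge0// invr_ge0 ltW.
move=> o x o0 ox; have [xr|rx] := leP `|x| r.
  rewrite -[leLHS]addr0 lerD//; last first.
    by rewrite mulr_ge0 ?quartic_ge0// exprn_ge0// addr_ge0// invr_ge0 ltW.
  suff h : o * expR (K * o) <= e by rewrite expr2 -mulrA mulrC ler_wpM2r.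
  have o1 : o <= 1.
    by apply: (le_trans ox); apply: (le_trans xr); rewrite ge_min lexx.
  have oe : o <= e * expR (- K).
    by apply: (le_trans ox); apply: (le_trans xr); rewrite ge_min lexx orbT.
  apply: (@le_trans _ _ (e * expR (- K) * expR K)); last first.
    by rewrite -mulrA (mulrC (expR _)) expRxMexpNx_1 mulr1.
  by apply: ler_pM => //; rewrite ?expR_ge0// ler_expR ler_piMr.
rewrite quartic_norm.
have w0 : 0 <= `|x| by [].
move: `|x| ox rx w0 => w ox rx w0.
rewrite -[leLHS]add0r lerD// ?mulr_ge0 ?(ltW e0)//.
have t1 : 1 <= K + 1 by rewrite lerDr.
set t := K + 1 in t1 *.
have tw0 : 0 <= t * w by rewrite mulr_ge0// (le_trans _ t1).
set s := expR (t * w) - expR (- (t * w)).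
have sr : r <= s.
  have h1 : 1 + t * w <= expR (t * w) := expR_ge1Dx _.
  have h2 : expR (- (t * w)) <= 1 by rewrite expR_le1 oppr_le0.
  have h3 : w <= t * w by rewrite ler_peMl.
  rewrite /s; lra.
have es : expR (t * w) <= s * (1 + r^-1).
  rewrite mulrDr mulr1.
  have : 1 <= s * r^-1 by rewrite ler_pdivlMr// mul1r.
  have h2 : expR (- (t * w)) <= 1 by rewrite expR_le1 oppr_le0.
  rewrite /s; lra.
apply: (@le_trans _ _ (expR (t * w) ^+ 4)); last first.
  have s0 : 0 <= s * (1 + r^-1) by rewrite (le_trans _ es)// expR_ge0.
  rewrite /quartic -/s -exprMn (mulrC _ s).
  by apply: lerXn2r; rewrite ?nnegrE ?expR_ge0.
have ow : o <= expR w by rewrite (le_trans ox)// (le_trans _ (expR_ge1Dx w))// lerDr.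
apply: (@le_trans _ _ (expR w ^+ 2 * expR (K * w))).
  apply: ler_pM; rewrite ?sqr_ge0 ?expR_ge0//.
    by apply: lerXn2r; rewrite ?nnegrE ?expR_ge0.
  by rewrite ler_expR ler_wpM2l.
rewrite -!expRM_natl -expRD ler_expR /t.
by nra.
Qed.

End exponential_bounds.

(** * The expected pushes of the reflected process *)

Section pushing_value.
Context {R : realType}.
Implicit Types c p q y : R.

(** The solution of f'' / 2 + mu f' = nu f on the interval from 0 to c with
    f'(0) = 0 and f'(c) = 1, where p and - q are the roots of
    r ^ 2 / 2 + mu r = nu.  Probabilistically, it is the expected amount of
    pushing down at the level c, up to an exponential time of rate nu, of the
    Brownian motion with drift mu started at y and reflected at 0 and c. *)
Definition upvalue c p q y : R :=
  (expR (p * y) / p + expR (- (q * y)) / q) / (expR (p * c) - expR (- (q * c))).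

(** The same for pushing up at the level 0, by reflection of the interval. *)
Definition downvalue c p q y : R := upvalue c q p (c - y).

Lemma upvalue_den c p q : 0 < c -> 0 < p -> 0 < q ->
  0 < expR (p * c) - expR (- (q * c)).
Proof.
move=> c0 p0 q0; rewrite subr_gt0 ltr_expR (@lt_trans _ _ 0)//.
  by rewrite oppr_lt0 mulr_gt0.
by rewrite mulr_gt0.
Qed.

Lemma upvalue_gt0 c p q y : 0 < c -> 0 < p -> 0 < q -> 0 < upvalue c p q y.
Proof.
move=> c0 p0 q0; rewrite /upvalue divr_gt0 ?upvalue_den//.
by rewrite addr_gt0// divr_gt0 ?expR_gt0.
Qed.

Lemma downvalue_gt0 c p q y : 0 < c -> 0 < p -> 0 < q -> 0 < downvalue c p q y.
Proof. by move=> c0 p0 q0; exact: upvalue_gt0. Qed.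

Let N c p q := expR (p * c) - expR (- (q * c)).

Let upvalueB c p q y o : 0 < c -> 0 < p -> 0 < q ->
  upvalue c p q (y + o) - upvalue c p q y =
  (expR (p * y) / p * (expR (p * o) - 1) +
   expR (- (q * y)) / q * (expR (- (q * o)) - 1)) / N c p q.
Proof.
move=> c0 p0 q0; rewrite /upvalue /N.
rewrite !mulrDr opprD !expRD; field.
by rewrite !gt_eqF//= -[X in _ < X]/(N c p q) upvalue_den.
Qed.

Let slope c p q y : 0 < c -> 0 < p -> 0 < q -> forall o,
  (expR (p * y) / p * (p * o) + expR (- (q * y)) / q * (- (q * o))) / N c p q
  = (expR (p * y) - expR (- (q * y))) / N c p q * o.
Proof.
move=> c0 p0 q0 o; rewrite /N; field.
by rewrite !gt_eqF//= -[X in _ < X]/(N c p q) upvalue_den.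
Qed.

(** The function is convex, hence above the affine pieces that continue it
    outside the interval. *)
Lemma upvalue_ge c p q y : 0 < c -> 0 < p -> 0 < q ->
  upvalue c p q (clip c y) + up c y <= upvalue c p q y.
Proof.
move=> c0 p0 q0.
have tangent z o : (expR (p * z) - expR (- (q * z))) / N c p q * o <=
    upvalue c p q (z + o) - upvalue c p q z.
  rewrite upvalueB// -slope// ler_wpM2r ?invr_ge0 ?(ltW (upvalue_den _ _ _))//.
  apply: lerD; apply: ler_wpM2l; rewrite ?lerBrDl ?expR_ge1Dx//.
    by rewrite divr_ge0 ?expR_ge0 ?ltW.
  by rewrite divr_ge0 ?expR_ge0 ?ltW.
case: overshootP => //.
- by rewrite addr0.
- move=> cy; have := tangent c (y - c).
  rewrite divff ?mul1r ?gt_eqF ?upvalue_den// (addrC c) subrK; lra.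
- move=> y0; have := tangent 0 y.
  rewrite !mulr0 oppr0 expR0 subrr mul0r mul0r add0r; lra.
Qed.

(** The tangents at the ends miss the function by a quadratic error only. *)
Lemma upvalue_le c p q : 0 < c -> 0 < p -> 0 < q ->
  exists2 M : R, 0 <= M & forall y, upvalue c p q y <=
    upvalue c p q (clip c y) + up c y
      + M * (over c y ^+ 2 * expR ((p + q) * over c y)).
Proof.
move=> c0 p0 q0.
have N0 : 0 < N c p q by exact: upvalue_den.
pose M z := (expR (p * z) * p + expR (- (q * z)) * q) / N c p q.
have M0 z : 0 <= M z.
  by rewrite divr_ge0 ?(ltW N0)// addr_ge0 ?mulr_ge0 ?expR_ge0 ?ltW.
have taylor z o : upvalue c p q (z + o) - upvalue c p q z <=
    (expR (p * z) - expR (- (q * z))) / N c p q * o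
    + M z * (`|o| ^+ 2 * expR ((p + q) * `|o|)).
  have -> : M z * (`|o| ^+ 2 * expR ((p + q) * `|o|)) =
    (expR (p * z) / p * ((p * o) ^+ 2 * expR ((p + q) * `|o|))
     + expR (- (q * z)) / q * ((- (q * o)) ^+ 2 * expR ((p + q) * `|o|)))
      / N c p q.
    rewrite -normrX ger0_norm ?sqr_ge0// /M; field.
    by rewrite !gt_eqF.
  rewrite upvalueB// -slope// -mulrDl ler_wpM2r ?invr_ge0 ?(ltW N0)//.
  rewrite addrACA -!mulrDr; apply: lerD; apply: ler_wpM2l.
  - by rewrite divr_ge0 ?expR_ge0 ?ltW.
  - rewrite lerBlDl addrA (le_trans (expR_le_sqr _))// lerD2l ler_wpM2l ?sqr_ge0//.
    by rewrite ler_expR normrM gtr0_norm// ler_wpM2r// lerDl ltW.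
  - by rewrite divr_ge0 ?expR_ge0 ?ltW.
  - rewrite lerBlDl addrA (le_trans (expR_le_sqr _))// lerD2l ler_wpM2l ?sqr_ge0//.
    by rewrite ler_expR normrN normrM (gtr0_norm q0) ler_wpM2r// lerDr ltW.
(* M z is the second derivative at z. *)
exists (M c + M 0); first exact: addr_ge0.
move=> y; rewrite /over; have Mc := M0 c; have M00 := M0 0.
case: overshootP => // [_ _|cy|y0].
- by rewrite addr0 lerDl addr0 expr0n mul0r mulr0.
- have := taylor c (y - c).
  rewrite divff ?mul1r ?gt_eqF// (addrC c) subrK gtr0_norm ?subr_gt0// addr0.
  have : 0 <= (y - c) ^+ 2 * expR ((p + q) * (y - c)).
    by rewrite mulr_ge0 ?sqr_ge0 ?expR_ge0.
  nra.
- have := taylor 0 y.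
  rewrite !mulr0 oppr0 expR0 subrr mul0r mul0r !add0r ltr0_norm// addr0.
  have : 0 <= (- y) ^+ 2 * expR ((p + q) * (- y)).
    by rewrite mulr_ge0 ?sqr_ge0 ?expR_ge0.
  nra.
Qed.

Lemma downvalue_ge c p q y : 0 < c -> 0 < p -> 0 < q ->
  downvalue c p q (clip c y) + down y <= downvalue c p q y.
Proof.
move=> c0 p0 q0; rewrite /downvalue -clip_sym// -(up_sym c).
exact: upvalue_ge.
Qed.

Lemma downvalue_le c p q : 0 < c -> 0 < p -> 0 < q ->
  exists2 M : R, 0 <= M & forall y, downvalue c p q y <=
    downvalue c p q (clip c y) + down y
      + M * (over c y ^+ 2 * expR ((p + q) * over c y)).
Proof.
move=> c0 p0 q0; have [M M0 leM] := upvalue_le c0 q0 p0.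
exists M => // y; rewrite /downvalue -clip_sym// -(up_sym c).
have -> : over c y = over c (c - y) by rewrite /over up_sym down_sym addrC.
by rewrite (addrC p).
Qed.

End pushing_value.

(** * Integration of nonnegative real functions *)

Section rint.
Context d (T : measurableType d) (R : realType).
Variable m : {measure set T -> \bar R}.
Implicit Types f g : T -> R.

Definition rint f : \bar R := (\int[m]_x (f x)%:E)%E.

Lemma rint_ge0 f : (forall x, 0 <= f x) -> (0 <= rint f)%E.
Proof. by move=> f0; apply: integral_ge0 => x _; rewrite lee_fin. Qed.

Lemma rintD f g : measurable_fun setT f -> measurable_fun setT g ->
  (forall x, 0 <= f x) -> (forall x, 0 <= g x) ->
  rint (fun x => f x + g x) = (rint f + rint g)%E.
Proof.
move=> mf mg f0 g0; rewrite /rint -ge0_integralD//.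
- by move=> x _; rewrite lee_fin.
- exact/measurable_EFinP.
- by move=> x _; rewrite lee_fin.
- exact/measurable_EFinP.
Qed.

Lemma rintZ k f : 0 <= k -> measurable_fun setT f -> (forall x, 0 <= f x) ->
  rint (fun x => k * f x) = (k%:E * rint f)%E.
Proof.
move=> k0 mf f0; rewrite /rint.
under eq_integral do rewrite EFinM.
rewrite ge0_integralZl//.
- exact/measurable_EFinP.
- by move=> x _; rewrite lee_fin.
Qed.

Lemma le_rint f g : measurable_fun setT f -> measurable_fun setT g ->
  (forall x, 0 <= f x) -> (forall x, f x <= g x) -> (rint f <= rint g)%E.
Proof.
move=> mf mg f0 fg; apply: ge0_le_integral => //.
- by move=> x _; rewrite lee_fin.
- exact/measurable_EFinP.
- exact/measurable_EFinP.
- by move=> x _; rewrite lee_fin.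
Qed.

End rint.

Lemma rint_cst d (T : measurableType d) (R : realType) (P : probability T R)
  (k : R) : rint P (fun=> k) = k%:E.
Proof. by rewrite /rint integral_cst//= (probability_setT P) mule1. Qed.

Section measurability.
Context d (T : measurableType d) (R : realType).
Implicit Types f g : T -> R.

Lemma measurable_expR_comp f : measurable_fun setT f ->
  measurable_fun setT (fun x => expR (f x)).
Proof. by move=> mf; exact: measurableT_comp. Qed.

Lemma measurable_clip c f : measurable_fun setT f ->
  measurable_fun setT (fun x => clip c (f x)).
Proof.
move=> mf; apply: measurable_maxr; first exact: measurable_cst.
by apply: measurable_minr => //; exact: measurable_cst.
Qed.

Lemma measurable_up c f : measurable_fun setT f ->
  measurable_fun setT (fun x => up c (f x)).
Proof.
move=> mf; apply: measurable_maxr; last exact: measurable_cst.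
by apply: measurable_funB => //; exact: measurable_cst.
Qed.

Lemma measurable_down f : measurable_fun setT f ->
  measurable_fun setT (fun x => down (f x)).
Proof.
move=> mf; apply: measurable_maxr; last exact: measurable_cst.
exact: measurable_funN.
Qed.

Lemma measurable_over c f : measurable_fun setT f ->
  measurable_fun setT (fun x => over c (f x)).
Proof.
by move=> mf; apply: measurable_funD;
  [exact: measurable_up | exact: measurable_down].
Qed.

Lemma measurable_upvalue c p q f : measurable_fun setT f ->
  measurable_fun setT (fun x => upvalue c p q (f x)).
Proof.
move=> mf; apply: measurable_funM; last exact: measurable_cst.
apply: measurable_funD; apply: measurable_funM; try exact: measurable_cst.
  by apply: measurable_expR_comp; apply: measurable_funM.
by apply/measurable_expR_comp/measurable_funN; apply: measurable_funM.
Qed.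

Lemma measurable_downvalue c p q f : measurable_fun setT f ->
  measurable_fun setT (fun x => downvalue c p q (f x)).
Proof.
by move=> mf; apply: measurable_upvalue; apply: measurable_funB.
Qed.

Lemma measurable_quartic t f : measurable_fun setT f ->
  measurable_fun setT (fun x => quartic t (f x)).
Proof.
move=> mf; apply: measurable_funX.
have mtf : measurable_fun setT (fun x => t * f x).
  exact: measurable_funM.
by apply: measurable_funB; apply: measurable_expR_comp => //;
  exact: measurable_funN.
Qed.

End measurability.

Ltac measurability := repeat lazymatch goal with
  | |- measurable_fun _ (fun x => (@?f x + @?g x)%R) =>
      apply: (@measurable_funD _ _ _ _ f g)
  | |- measurable_fun _ (GRing.add ?y) =>
      apply: (@measurable_funD _ _ _ _ (cst y) id)
  | |- measurable_fun _ (fun x => (- @?f x)%R) =>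
      apply: (@measurable_funN _ _ _ _ f)
  | |- measurable_fun _ (fun x => (@?f x * @?g x)%R) =>
      apply: (@measurable_funM _ _ _ _ f g)
  | |- measurable_fun _ (fun x => (@?f x ^+ ?n)%R) =>
      apply: (@measurable_funX _ _ _ _ f n)
  | |- measurable_fun _ (fun x => clip ?c (@?f x)) =>
      apply: (@measurable_clip _ _ _ c f)
  | |- measurable_fun _ (fun x => up ?c (@?f x)) =>
      apply: (@measurable_up _ _ _ c f)
  | |- measurable_fun _ (fun x => down (@?f x)) =>
      apply: (@measurable_down _ _ _ f)
  | |- measurable_fun _ (fun x => over ?c (@?f x)) =>
      apply: (@measurable_over _ _ _ c f)
  | |- measurable_fun _ (fun x => upvalue ?c ?p ?q (@?f x)) =>
      apply: (@measurable_upvalue _ _ _ c p q f)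
  | |- measurable_fun _ (fun x => downvalue ?c ?p ?q (@?f x)) =>
      apply: (@measurable_downvalue _ _ _ c p q f)
  | |- measurable_fun _ (fun x => quartic ?t (@?f x)) =>
      apply: (@measurable_quartic _ _ _ t f)
  | |- measurable_fun _ (fun x => expR (@?f x)) =>
      apply: (@measurable_expR_comp _ _ _ f)
  | |- measurable_fun _ (fun x => fst (@?f x)) =>
      apply: (@measurableT_comp _ _ _ _ _ _ fst _ f);
        [exact: measurable_fst|]
  | |- measurable_fun _ (fun x => snd (@?f x)) =>
      apply: (@measurableT_comp _ _ _ _ _ _ snd _ f);
        [exact: measurable_snd|]
  | |- measurable_fun _ _ => first
      [ assumption | exact: measurable_id | exact: measurable_cst
      | exact: mulrl_measurable | exact: measurable_fst
      | exact: measurable_snd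
      | apply: measurable_quartic; exact: measurable_id
      | apply: measurable_up; exact: measurable_id
      | apply: measurable_down; exact: measurable_id ]
  end.

(** * One Gaussian step *)

Section gaussian_step.
Context {R : realType}.
Variables mu : R.
Implicit Types (h k t : R) (f g : R -> R).

(** The mean of [f] at the increment over a time [h] of a Brownian motion with
    drift [mu]. *)
Definition gstep (h : R) (f : R -> R) : \bar R :=
  rint (normal_prob 0 (Num.sqrt h)) (fun x => f (x + mu * h)).

Lemma gstep_ge0 h f : (forall x, 0 <= f x) -> (0 <= gstep h f)%E.
Proof. by move=> f0; exact: rint_ge0. Qed.

Let mshift h : measurable_fun [set: R] (fun x : R => x + mu * h).
Proof. by measurability. Qed.

Lemma gstepD h f g : measurable_fun [set: R] f -> measurable_fun [set: R] g ->
  (forall x, 0 <= f x) -> (forall x, 0 <= g x) ->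
  gstep h (fun x => f x + g x) = (gstep h f + gstep h g)%E.
Proof.
by move=> mf mg f0 g0; rewrite /gstep rintD//;
  [exact: (measurableT_comp mf (mshift h))
  |exact: (measurableT_comp mg (mshift h))].
Qed.

Lemma gstepZ h k f : 0 <= k -> measurable_fun [set: R] f ->
  (forall x, 0 <= f x) -> gstep h (fun x => k * f x) = (k%:E * gstep h f)%E.
Proof.
move=> k0 mf f0; rewrite /gstep rintZ//.
exact: (measurableT_comp mf (mshift h)).
Qed.

Lemma le_gstep h f g : measurable_fun [set: R] f -> measurable_fun [set: R] g ->
  (forall x, 0 <= f x) -> (forall x, f x <= g x) ->
  (gstep h f <= gstep h g)%E.
Proof.
by move=> mf mg f0 fg; apply: le_rint => //;
  [exact: (measurableT_comp mf (mshift h))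
  |exact: (measurableT_comp mg (mshift h))].
Qed.

Lemma gstep_cst h (k : R) : gstep h (fun=> k) = k%:E.
Proof. exact: rint_cst. Qed.

Lemma gstep_expR h t : 0 < h ->
  gstep h (fun x => expR (t * x)) = (expR ((t * mu + t ^+ 2 / 2) * h))%:E.
Proof.
move=> h0; rewrite /gstep.
have -> : (fun x => expR (t * (x + mu * h))) =
    (fun x => expR (t * mu * h) * expR (t * x)).
  by apply/funext => x; rewrite -expRD; congr expR; ring.
rewrite rintZ ?expR_ge0//; last by measurability.
rewrite /rint normal_prob_expR ?gt_eqF ?sqrtr_gt0//.
rewrite -EFinM -expRD sqr_sqrtr ?ltW//; congr (expR _)%:E; ring.
Qed.

(** The terms of order 0 and 1 in [h] cancel. *)
Lemma gstep_quartic t : exists2 C : R, 0 <= C & forall h, 0 < h -> h <= 1 ->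
  (gstep h (quartic t) <= (C * h ^+ 2)%:E)%E.
Proof.
(* expR (u s * h) is the mean of the exponential with exponent s * t. *)
pose u s := (s * t) * mu + (s * t) ^+ 2 / 2.
have gE s h : 0 < h -> gstep h (fun x => expR (s * t * x)) = (expR (u s * h))%:E.
  by move=> h0; rewrite gstep_expR.
have m1 s : measurable_fun [set: R] (fun x : R => expR (s * t * x)).
  by measurability.
have p1 s x : 0 <= expR (s * t * x) by exact: expR_ge0.
have bound h s : 0 < h -> h <= 1 ->
    expR (u s * h) <= 1 + u s * h + u s ^+ 2 * expR `|u s| * h ^+ 2.
  move=> h0 h1; apply: (le_trans (expR_le_sqr _)); rewrite lerD2l exprMn.
  rewrite mulrAC ler_wpM2r ?sqr_ge0// ler_wpM2l ?sqr_ge0// ler_expR.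
  by rewrite normrM (gtr0_norm h0) ler_piMr.
exists (u 4 ^+ 2 * expR `|u 4| + u (- 4) ^+ 2 * expR `|u (- 4)|).
  by rewrite addr_ge0// mulr_ge0 ?sqr_ge0 ?expR_ge0.
move=> h h0 h1.
have : gstep h (fun x => quartic t x + 4 * (expR (2 * t * x) + expR (- 2 * t * x)))
    = gstep h (fun x => expR (4 * t * x) + expR (- 4 * t * x) + 6).
  by congr gstep; apply/funext => x; rewrite quarticE.
rewrite gstepD; [|by measurability|by measurability|exact: quartic_ge0|
  by move=> x; rewrite mulr_ge0 ?addr_ge0].
rewrite gstepZ//; last by measurability.
rewrite gstepD// gstepD//; last by measurability.
rewrite gstepD// gstep_cst !gE// -!EFinD -EFinM.
move=> e.
have := bound h 4 h0 h1; have := bound h (- 4) h0 h1.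
have := expR_ge1Dx (u 2 * h); have := expR_ge1Dx (u (- 2) * h).
have fin : gstep h (quartic t) \is a fin_num.
  rewrite ge0_fin_numE ?gstep_ge0 ?quartic_ge0//; last exact: quartic_ge0.
  rewrite (@le_lt_trans _ _ (gstep h (quartic t) +
    (4 * (expR (u 2 * h) + expR (u (- 2) * h)))%:E)%E)//.
    by rewrite leeDl// lee_fin mulr_ge0// addr_ge0// expR_ge0.
  by rewrite e ltry.
move: e; rewrite -(fineK fin) -EFinD => -[e].
rewrite lee_fin => h2 h3 h4 h5.
have uE : u 4 + u (- 4) = 4 * (u 2 + u (- 2)) by rewrite /u; field.
have uEh : u 4 * h + u (- 4) * h = 4 * (u 2 * h + u (- 2) * h).
  by rewrite -mulrDl uE; ring.
lra.
Qed.

End gaussian_step.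

(** * The expected pushes after one Gaussian step *)

Section pushing_step.
Context {R : realType}.
Variables (mu c nu p q : R).
Implicit Types h y e : R.
Hypotheses (c0 : 0 < c) (p0 : 0 < p) (q0 : 0 < q).
Hypotheses (rootp : p * mu + p ^+ 2 / 2 = nu)
  (rootq : - q * mu + q ^+ 2 / 2 = nu).
Local Notation A := (upvalue c p q).
Local Notation D := (downvalue c p q).
Local Notation gstep := (gstep mu).

Let gstep_expR2 h C1 C2 : 0 < h -> 0 <= C1 -> 0 <= C2 ->
  gstep h (fun x => C1 * expR (p * x) + C2 * expR (- q * x))
  = (expR (nu * h) * (C1 + C2))%:E.
Proof.
move=> h0 C10 C20; rewrite gstepD; first last.
- by move=> x; rewrite mulr_ge0 ?expR_ge0.
- by move=> x; rewrite mulr_ge0 ?expR_ge0.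
- by measurability.
- by measurability.
rewrite !gstepZ//; try by measurability.
by rewrite !gstep_expR// rootp sqrrN rootq -!EFinM -EFinD mulrDr mulrC (mulrC C2).
Qed.

(** Exponentials with exponents [p] and [- q] are exact eigenfunctions of the
    Gaussian step. *)
Lemma gstep_upvalue h y : 0 < h ->
  gstep h (fun x => A (y + x)) = (expR (nu * h) * A y)%:E.
Proof.
move=> h0; have N0 := upvalue_den c0 p0 q0.
set N := expR (p * c) - _ in N0.
have -> : A y = expR (p * y) / p / N + expR (- (q * y)) / q / N.
  by rewrite /upvalue mulrDl.
rewrite -gstep_expR2 ?divr_ge0 ?expR_ge0 ?ltW//.
congr gstep; apply/funext => x; rewrite /upvalue -/N.
rewrite !mulrDr opprD !expRD -!mulNr; field.
by rewrite !gt_eqF.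
Qed.

Lemma gstep_downvalue h y : 0 < h ->
  gstep h (fun x => D (y + x)) = (expR (nu * h) * D y)%:E.
Proof.
move=> h0; have N0 := upvalue_den c0 q0 p0.
set N := expR (q * c) - _ in N0.
have -> : D y = expR (- (p * (c - y))) / p / N + expR (q * (c - y)) / q / N.
  by rewrite /downvalue /upvalue mulrDl addrC.
rewrite -gstep_expR2 ?divr_ge0 ?expR_ge0 ?ltW//.
congr gstep; apply/funext => x; rewrite /downvalue /upvalue -/N.
have -> : expR (q * (c - (y + x))) = expR (q * (c - y)) * expR (- q * x).
  by rewrite -expRD; congr expR; ring.
have -> : expR (- (p * (c - (y + x)))) = expR (- (p * (c - y))) * expR (p * x).
  by rewrite -expRD; congr expR; ring.
field.
by rewrite !gt_eqF.
Qed.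

(** The reflected walk loses, on average, at least what it is pushed. *)
Lemma gstep_up_le h y : 0 < h ->
  (gstep h (fun x => A (clip c (y + x)) + up c (y + x))%R
   <= (expR (nu * h) * A y)%:E)%E.
Proof.
move=> h0; rewrite -gstep_upvalue//; apply: le_gstep; try by measurability.
  by move=> x; rewrite addr_ge0 ?up_ge0// ltW// upvalue_gt0.
by move=> x; exact: upvalue_ge.
Qed.

Lemma gstep_down_le h y : 0 < h ->
  (gstep h (fun x => D (clip c (y + x)) + down (y + x))%R
   <= (expR (nu * h) * D y)%:E)%E.
Proof.
move=> h0; rewrite -gstep_downvalue//; apply: le_gstep; try by measurability.
  by move=> x; rewrite addr_ge0 ?down_ge0// ltW// downvalue_gt0.
by move=> x; exact: downvalue_ge.
Qed.

(** The square of an overshoot is negligible with respect to the overshoot. *)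
Lemma gstep_over_sqr (K e : R) : 0 <= K -> 0 < e ->
  exists2 C : R, 0 <= C & forall h y, 0 < h -> h <= 1 -> 0 <= y -> y <= c ->
  (gstep h (fun x => over c (y + x) ^+ 2 * expR (K * over c (y + x)))%R
   <= gstep h (fun x => e * over c (y + x) + C * h ^+ 2)%R)%E.
Proof.
move=> K0 e0; have [C1 C10 C1P] := overshoot_sqr K0 e0.
have [C2 C20 C2P] := gstep_quartic mu (K + 1).
exists (C1 * C2); first exact: mulr_ge0.
move=> h y h0 h1 y0 yc.
have og x : 0 <= e * over c (y + x) by rewrite mulr_ge0 ?over_ge0 ?ltW.
have Cq x : 0 <= C1 * quartic (K + 1) x by rewrite mulr_ge0 ?quartic_ge0.
apply: (@le_trans _ _ (gstep h (fun x => e * over c (y + x)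
    + C1 * quartic (K + 1) x)%R)).
  apply: le_gstep; try by measurability.
    by move=> x; rewrite mulr_ge0 ?sqr_ge0 ?expR_ge0.
  by move=> x; apply: C1P; [exact: over_ge0 | exact: over_le].
rewrite gstepD//; try by measurability.
rewrite [leRHS]gstepD//; try by [measurability | rewrite !mulr_ge0 ?sqr_ge0].
rewrite leeD2l// gstep_cst gstepZ//; [|by measurability|exact: quartic_ge0].
rewrite -mulrA EFinM lee_wpmul2l ?lee_fin//; first exact: C2P.
by move=> _; rewrite mulr_ge0 ?sqr_ge0// mulr_ge0.
Qed.

Let value_ge (F : R -> R) (u : R -> R) (M e : R) : 0 <= M -> 0 < e ->
  measurable_fun [set: R] F -> measurable_fun [set: R] u ->
  (forall y, 0 <= F y) -> (forall y, 0 <= u y) ->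
  (forall h y, 0 < h ->
     gstep h (fun x => F (y + x)) = (expR (nu * h) * F y)%:E) ->
  (forall y, F y <= F (clip c y) + u y
      + M * (over c y ^+ 2 * expR ((p + q) * over c y))) ->
  exists2 C : R, 0 <= C & forall h y, 0 < h -> h <= 1 -> 0 <= y -> y <= c ->
  ((expR (nu * h) * F y)%:E <=
   gstep h (fun x => F (clip c (y + x)) + u (y + x)
     + (e * over c (y + x) + C * h ^+ 2))%R)%E.
Proof.
move=> M0 e0 mF mu' F0 u0 gF leF.
have e0' : 0 < e / (M + 1) by rewrite divr_gt0// ltr_wpDl.
have pq0 : 0 <= p + q by rewrite addr_ge0 ?ltW.
have [C C0 CP] := gstep_over_sqr pq0 e0'.
exists (M * C); first exact: mulr_ge0.
move=> h y h0 h1 y0 yc.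
have mFc : measurable_fun [set: R] (fun x => F (clip c (y + x))).
  by apply: (measurableT_comp mF); measurability.
have muy : measurable_fun [set: R] (fun x => u (y + x)).
  by apply: (measurableT_comp mu'); measurability.
have mFy : measurable_fun [set: R] (fun x => F (y + x)).
  by apply: (measurableT_comp mF); measurability.
have o0 x : 0 <= over c (y + x) by exact: over_ge0.
have oe0 x : 0 <= over c (y + x) ^+ 2 * expR ((p + q) * over c (y + x)).
  by rewrite mulr_ge0 ?sqr_ge0 ?expR_ge0.
have h20 : 0 <= h ^+ 2 by exact: sqr_ge0.
rewrite -gF//.
apply: (@le_trans _ _ (gstep h (fun x => F (clip c (y + x)) + u (y + x)
  + M * (over c (y + x) ^+ 2 * expR ((p + q) * over c (y + x)))))).
  by apply: le_gstep => //; measurability.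
rewrite gstepD//; try by [measurability | move=> x; rewrite ?addr_ge0 ?mulr_ge0].
rewrite [leRHS]gstepD//; try by [measurability |
  move=> x; rewrite ?addr_ge0 ?mulr_ge0 ?(ltW e0)].
rewrite leeD2l// gstepZ//; last by measurability.
apply: (@le_trans _ _ (M%:E * gstep h (fun x => e / (M + 1) * over c (y + x)
    + C * h ^+ 2)%R)%E).
  by rewrite lee_wpmul2l ?lee_fin//; exact: CP.
have eo0 x : 0 <= e / (M + 1) * over c (y + x) + C * h ^+ 2.
  by rewrite addr_ge0// mulr_ge0// ltW.
rewrite -gstepZ//; last by measurability.
apply: le_gstep; try by measurability.
  by move=> x; rewrite mulr_ge0.
have Me : M * (e / (M + 1)) <= e.
  by rewrite mulrCA ger_pMr// ler_pdivrMr ?ltr_wpDl// mul1r lerDl.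
  by move=> x; have := ler_wpM2r (o0 x) Me; lra.
move=> x; apply: addr_ge0; apply: mulr_ge0 => //; first exact: ltW.
exact: mulr_ge0.
Qed.

(** Conversely it loses hardly more, up to a small multiple of the overshoot. *)
Lemma gstep_up_ge (e : R) : 0 < e ->
  exists2 C : R, 0 <= C & forall h y, 0 < h -> h <= 1 -> 0 <= y -> y <= c ->
  ((expR (nu * h) * A y)%:E <=
   gstep h (fun x => A (clip c (y + x)) + up c (y + x)
     + (e * over c (y + x) + C * h ^+ 2))%R)%E.
Proof.
move=> e0; have [M M0 MP] := upvalue_le c0 p0 q0.
apply: (value_ge (u := up c) M0 e0 _ _ _ _ _ MP).
- by apply: measurable_upvalue; measurability.
- by measurability.
- by move=> y; rewrite ltW// upvalue_gt0.
- exact: up_ge0.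
- by move=> h y h0; exact: gstep_upvalue.
Qed.

Lemma gstep_down_ge (e : R) : 0 < e ->
  exists2 C : R, 0 <= C & forall h y, 0 < h -> h <= 1 -> 0 <= y -> y <= c ->
  ((expR (nu * h) * D y)%:E <=
   gstep h (fun x => D (clip c (y + x)) + down (y + x)
     + (e * over c (y + x) + C * h ^+ 2))%R)%E.
Proof.
move=> e0; have [M M0 MP] := downvalue_le c0 p0 q0.
apply: (value_ge (u := down) M0 e0 _ _ _ _ _ MP).
- by apply: measurable_downvalue; measurability.
- by measurability.
- by move=> y; rewrite ltW// downvalue_gt0.
- exact: down_ge0.
- by move=> h y h0; exact: gstep_downvalue.
Qed.

End pushing_step.

(** * The two reflected walks and their potentials *)

Section nonnegative_measurable.
Context d (T : measurableType d) (R : realType).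
Implicit Types f g : T -> R.

(** The functions whose means are formed below, as a class closed under sums,
    products and composition. *)
Definition nnm f := measurable_fun setT f /\ forall x, 0 <= f x.

Lemma nnm_cst k : 0 <= k -> nnm (fun=> k).
Proof. by move=> k0; split=> //; exact: measurable_cst. Qed.

Lemma nnmD f g : nnm f -> nnm g -> nnm (fun x => f x + g x).
Proof.
move=> [mf f0] [mg g0]; split; first by measurability.
by move=> x; exact: addr_ge0.
Qed.

Lemma nnmM f g : nnm f -> nnm g -> nnm (fun x => f x * g x).
Proof.
move=> [mf f0] [mg g0]; split; first by measurability.
by move=> x; exact: mulr_ge0.
Qed.

Lemma nnmZ k f : 0 <= k -> nnm f -> nnm (fun x => k * f x).
Proof. by move=> k0; apply: nnmM; exact: nnm_cst. Qed.

Lemma nnm_sqr f : nnm f -> nnm (fun x => f x ^+ 2).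
Proof. by move=> [mf f0]; split; [measurability | move=> x; exact: sqr_ge0]. Qed.

Lemma nnm_up c f : measurable_fun setT f -> nnm (fun x => up c (f x)).
Proof. by move=> mf; split; [measurability | move=> x; exact: up_ge0]. Qed.

Lemma nnm_down f : measurable_fun setT f -> nnm (fun x => down (f x)).
Proof. by move=> mf; split; [measurability | move=> x; exact: down_ge0]. Qed.

Lemma nnm_over c f : measurable_fun setT f -> nnm (fun x => over c (f x)).
Proof. by move=> mf; split; [measurability | move=> x; exact: over_ge0]. Qed.

Lemma nnm_upvalue c p q f : 0 < c -> 0 < p -> 0 < q ->
  measurable_fun setT f -> nnm (fun x => upvalue c p q (f x)).
Proof.
move=> c0 p0 q0 mf; split; first by measurability.
by move=> x; rewrite ltW// upvalue_gt0.
Qed.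

Lemma nnm_downvalue c p q f : 0 < c -> 0 < p -> 0 < q ->
  measurable_fun setT f -> nnm (fun x => downvalue c p q (f x)).
Proof.
move=> c0 p0 q0 mf; split; first by measurability.
by move=> x; rewrite ltW// downvalue_gt0.
Qed.

End nonnegative_measurable.

Lemma nnm_comp d1 d2 (T1 : measurableType d1) (T2 : measurableType d2)
    (R : realType) (f : T2 -> R) (g : T1 -> T2) :
  nnm f -> measurable_fun setT g -> nnm (fun x => f (g x)).
Proof. by move=> [mf f0] mg; split => //; exact: measurableT_comp. Qed.

Section step_domination.
Context {R : realType}.
Variables mu h : R.
Implicit Types f g : R -> R.

(** Comparison of means instead of values.  The means are extended reals, so
    that it makes sense also for infinite ones; it respects sums and
    nonnegative multiples. *)
Definition step_dom f g := [/\ nnm f, nnm g & (gstep mu h f <= gstep mu h g)%E].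

Lemma step_dom_pointwise f g : nnm f -> nnm g -> (forall x, f x <= g x) -> step_dom f g.
Proof.
by move=> nf ng fg; split=> //; apply: le_gstep => //; [exact: nf.1|exact: ng.1|exact: nf.2].
Qed.

Lemma step_dom_refl f : nnm f -> step_dom f f.
Proof. by move=> nf; split. Qed.

Lemma step_dom_trans g f k : step_dom f g -> step_dom g k -> step_dom f k.
Proof. by move=> [nf ng fg] [_ nk gk]; split=> //; exact: le_trans gk. Qed.

Lemma step_domD f1 g1 f2 g2 : step_dom f1 g1 -> step_dom f2 g2 ->
  step_dom (fun x => f1 x + f2 x) (fun x => g1 x + g2 x).
Proof.
move=> [[mf1 nf1] [mg1 ng1] le1] [[mf2 nf2] [mg2 ng2] le2].
by split; [exact: nnmD|exact: nnmD|rewrite !gstepD// leeD].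
Qed.

Lemma step_domZ k f g : 0 <= k -> step_dom f g ->
  step_dom (fun x => k * f x) (fun x => k * g x).
Proof.
move=> k0 [[mf nf] [mg ng] le1].
by split; [exact: nnmZ|exact: nnmZ|rewrite !gstepZ// lee_wpmul2l].
Qed.

End step_domination.

Section reflected_walks.
Context {R : realType}.
Implicit Types (s : R * R * R) (x : R).

(** The states are triples (a, b, z): two walks [a] and [b], moved by the same
    increments and kept between 0 and c, and the accumulated amount [z] by
    which [a] has been pushed down at the level c and [b] pushed up at the
    level 0. *)
Definition pushstep (c : R) s x : R * R * R :=
  (clip c (s.1.1 + x), clip c (s.1.2 + x),
   s.2 + up c (s.1.1 + x) + down (s.1.2 + x)).

Definition admissible (c : R) s : Prop :=
  [/\ 0 <= s.1.1, s.1.1 <= s.1.2, s.1.2 <= c & 0 <= s.2].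

Lemma admissible_pushstep c s x : 0 < c -> admissible c s ->
  admissible c (pushstep c s x).
Proof.
move=> c0 [a0 ab bc z0]; split; rewrite /= ?clip_ge0 ?clip_le//.
  by rewrite clip_homo// lerD2r.
by rewrite !addr_ge0 ?up_ge0 ?down_ge0.
Qed.

Lemma measurable_pushstep c : measurable_fun
  [set: (R * R * R) * R] (fun sx => pushstep c sx.1 sx.2).
Proof.
have ma : measurable_fun [set: (R * R * R) * R] (fun sx => sx.1.1.1 + sx.2).
  by measurability.
have mb : measurable_fun [set: (R * R * R) * R] (fun sx => sx.1.1.2 + sx.2).
  by measurability.
have mz : measurable_fun [set: (R * R * R) * R] (fun sx => sx.1.2).
  by measurability.
apply: measurable_fun_pair; first apply: measurable_fun_pair.
- by measurability.
- by measurability.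
- by measurability.
Qed.

Definition total_over (c : R) (sx : (R * R * R) * R) : R :=
  over c (sx.1.1.1 + sx.2) + over c (sx.1.1.2 + sx.2).

(** One quadratic function for both moments: the first one is th = 0, ka = 1,
    the second one th = 1, ka = 0. *)
Definition moment (th ka z : R) : R := th * z ^+ 2 + ka * z.

End reflected_walks.

Section potentials.
Context {R : realType}.
Variables (c p q th ka : R).
Hypotheses (c0 : 0 < c) (p0 : 0 < p) (q0 : 0 < q) (th0 : 0 <= th) (ka0 : 0 <= ka).
Local Notation A := (upvalue c p q).
Local Notation D := (downvalue c p q).
Implicit Types (s : R * R * R) (x z : R).

(** The coefficients of A a and D b in the potential.  The last terms are
    twice the sum of both values at the level where the push takes place. *)
Definition upcoef z : R := 2 * th * z + ka + th * (2 * (A c + D c)).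
Definition downcoef z : R := 2 * th * z + ka + th * (2 * (A 0 + D 0)).

(** The candidate for the mean of [moment th ka] of the final amount of
    pushing, when the walks stop at an independent exponential time. *)
Definition potential s : R :=
  moment th ka s.2 + upcoef s.2 * A s.1.1 + downcoef s.2 * D s.1.2.

(** The coefficients are chosen such that pushing leaves the potential
    unchanged to first order.  Since [a <= b], the walk [a] is pushed at the
    level c only if [b] is there as well, and [b] at the level 0 only if [a]
    is there, so that only the values of A + D at 0 and c matter. *)
Lemma potential_pushstep s x : admissible c s ->
  potential (pushstep c s x) = moment th ka s.2
  + upcoef s.2 * (A (clip c (s.1.1 + x)) + up c (s.1.1 + x))
  + downcoef s.2 * (D (clip c (s.1.2 + x)) + down (s.1.2 + x))
  + th * (up c (s.1.1 + x) ^+ 2 + down (s.1.2 + x) ^+ 2).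
Proof.
case: s => -[a b] z [/= a0 ab bc z0].
rewrite /potential /upcoef /downcoef /moment /=.
by case: (overshootP (a + x) c0); case: (overshootP (b + x) c0) => *; (ring || lra).
Qed.

Lemma upcoef_ge0 z : 0 <= z -> 0 <= upcoef z.
Proof.
move=> z0; have := upvalue_gt0 c c0 p0 q0; have := downvalue_gt0 c c0 p0 q0.
move=> D0 A0; rewrite /upcoef; apply: addr_ge0.
  by rewrite addr_ge0// mulr_ge0// mulr_ge0.
by rewrite mulr_ge0// mulr_ge0// ltW// addr_gt0.
Qed.

Lemma downcoef_ge0 z : 0 <= z -> 0 <= downcoef z.
Proof.
move=> z0; have := upvalue_gt0 0 c0 p0 q0; have := downvalue_gt0 0 c0 p0 q0.
move=> D0 A0; rewrite /downcoef; apply: addr_ge0.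
  by rewrite addr_ge0// mulr_ge0// mulr_ge0.
by rewrite mulr_ge0// mulr_ge0// ltW// addr_gt0.
Qed.

Lemma moment_ge0 z : 0 <= z -> 0 <= moment th ka z.
Proof. by move=> z0; rewrite /moment addr_ge0 ?mulr_ge0 ?sqr_ge0. Qed.

Lemma potential_ge0 s : 0 <= s.2 -> 0 <= potential s.
Proof.
move=> z0; apply: addr_ge0; first apply: addr_ge0; first exact: moment_ge0.
  by apply: mulr_ge0; [exact: upcoef_ge0 | rewrite ltW// upvalue_gt0].
by apply: mulr_ge0; [exact: downcoef_ge0 | rewrite ltW// downvalue_gt0].
Qed.

End potentials.

(** * The potentials after one Gaussian step *)

Section potential_step.
Context {R : realType}.
Variables (mu c nu p q : R).
Hypotheses (c0 : 0 < c) (p0 : 0 < p) (q0 : 0 < q).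
Hypotheses (rootp : p * mu + p ^+ 2 / 2 = nu)
  (rootq : - q * mu + q ^+ 2 / 2 = nu).
Local Notation A := (upvalue c p q).
Local Notation D := (downvalue c p q).
Implicit Types (s : R * R * R) (h x z e th ka : R).

Let mtrans (y : R) : measurable_fun [set: R] (fun x => y + x).
Proof. by measurability. Qed.

Let nnm_upstep y : nnm (fun x => A (clip c (y + x)) + up c (y + x)).
Proof.
apply: nnmD; first by apply: nnm_upvalue => //; measurability.
exact: nnm_up.
Qed.

Let nnm_downstep y : nnm (fun x => D (clip c (y + x)) + down (y + x)).
Proof.
apply: nnmD; first by apply: nnm_downvalue => //; measurability.
exact: nnm_down.
Qed.

Let A0 y : 0 <= A y. Proof. by rewrite ltW// upvalue_gt0. Qed.
Let D0 y : 0 <= D y. Proof. by rewrite ltW// downvalue_gt0. Qed.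

Let step_dom_up h y : 0 < h ->
  step_dom mu h (fun x => A (clip c (y + x)) + up c (y + x))
    (fun=> expR (nu * h) * A y).
Proof.
move=> h0; split; first exact: nnm_upstep.
  by apply: nnm_cst; rewrite mulr_ge0 ?expR_ge0.
by rewrite gstep_cst; exact: gstep_up_le.
Qed.

Let step_dom_down h y : 0 < h ->
  step_dom mu h (fun x => D (clip c (y + x)) + down (y + x))
    (fun=> expR (nu * h) * D y).
Proof.
move=> h0; split; first exact: nnm_downstep.
  by apply: nnm_cst; rewrite mulr_ge0 ?expR_ge0.
by rewrite gstep_cst; exact: gstep_down_le.
Qed.

Let nnm_err e C h y : 0 < e -> 0 <= C ->
  nnm (fun x => e * over c (y + x) + C * h ^+ 2).
Proof.
move=> e0 C0; apply: nnmD; first by apply: nnmZ; [exact: ltW|exact: nnm_over].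
by apply: nnm_cst; rewrite mulr_ge0 ?sqr_ge0.
Qed.

Let step_dom_sqr e : 0 < e -> exists2 C : R, 0 <= C &
  forall h y, 0 < h -> h <= 1 -> 0 <= y -> y <= c ->
  step_dom mu h (fun x => over c (y + x) ^+ 2)
    (fun x => e * over c (y + x) + C * h ^+ 2).
Proof.
move=> e0; have [C C0 CP] := gstep_over_sqr mu c0 (lexx 0) e0.
exists C => // h y h0 h1 y0 yc; split.
- by apply: nnm_sqr; exact: nnm_over.
- exact: nnm_err.
- have := CP h y h0 h1 y0 yc.
  by congr (gstep _ _ _ <= _)%E; apply/funext => x; rewrite mul0r expR0 mulr1.
Qed.

Let coefs_ge0 th ka z : 0 <= th -> 0 <= ka -> 0 <= z ->
  [/\ 0 <= moment th ka z, 0 <= upcoef c p q th ka z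
    & 0 <= downcoef c p q th ka z].
Proof.
by move=> th0 ka0 z0; split; [exact: moment_ge0|exact: upcoef_ge0|exact: downcoef_ge0].
Qed.

Let nnm_potential th ka s : 0 <= th -> 0 <= ka -> admissible c s ->
  nnm (fun x => potential c p q th ka (pushstep c s x)).
Proof.
move=> th0 ka0 s0; have [_ _ _ z0] := s0.
have [m0 u0 v0] := coefs_ge0 th0 ka0 z0.
rewrite (_ : (fun x => _) = (fun x => moment th ka s.2
  + upcoef c p q th ka s.2 * (A (clip c (s.1.1 + x)) + up c (s.1.1 + x))
  + downcoef c p q th ka s.2 * (D (clip c (s.1.2 + x)) + down (s.1.2 + x))
  + th * (up c (s.1.1 + x) ^+ 2 + down (s.1.2 + x) ^+ 2))).
  apply: nnmD; first apply: nnmD; first apply: nnmD.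
  - exact: nnm_cst.
  - exact: nnmZ.
  - exact: nnmZ.
  - by apply: nnmZ => //; apply: nnmD; apply: nnm_sqr; [exact: nnm_up|exact: nnm_down].
by apply/funext => x; exact: potential_pushstep.
Qed.

Let expRB1_ge0 h : 0 < nu -> 0 < h -> 0 <= expR (nu * h) - 1.
Proof. by move=> nu0 h0; rewrite subr_ge0 -[leLHS]expR0 ler_expR mulr_ge0 ?ltW. Qed.

(** Up to the squared pushes, the potential is discounted to at most its own
    value minus the running reward. *)
Lemma potential_step_le e : 0 < nu -> 0 < e -> exists2 C : R, 0 <= C &
  forall th ka h s, 0 <= th -> 0 <= ka -> 0 < h -> h <= 1 -> admissible c s ->
  step_dom mu h
    (fun x => potential c p q th ka (pushstep c s x)
       + (expR (nu * h) - 1) * moment th ka s.2)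
    (fun x => expR (nu * h) * potential c p q th ka s
       + th * (e * total_over c (s, x) + C * h ^+ 2)).
Proof.
move=> nu0 e0; have [C C0 CP] := step_dom_sqr e0.
exists (C + C); first exact: addr_ge0.
move=> th ka h s th0 ka0 h0 h1 s0; have [a0 ab bc z0] := s0.
have [m0 u0 v0] := coefs_ge0 th0 ka0 z0.
have a1 := le_trans ab bc; have b0 := le_trans a0 ab.
pose m := moment th ka s.2.
have E0 := expRB1_ge0 nu0 h0.
have Em0 : 0 <= expR (nu * h) * m by rewrite mulr_ge0 ?expR_ge0.
have Pa : nnm (fun x => over c (s.1.1 + x)) by exact: nnm_over.
have Pb : nnm (fun x => over c (s.1.2 + x)) by exact: nnm_over.
have gm : step_dom mu h (fun=> expR (nu * h) * m) (fun=> expR (nu * h) * m).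
  by apply: step_dom_refl; exact: nnm_cst.
have H := step_domD (step_domD (step_domD gm
   (step_domZ u0 (step_dom_up s.1.1 h0))) (step_domZ v0 (step_dom_down s.1.2 h0)))
  (step_domZ th0 (step_domD (CP h s.1.1 h0 h1 a0 a1) (CP h s.1.2 h0 h1 b0 bc))).
apply: step_dom_trans (step_dom_trans H _).
- have [nH _ _] := H; apply: (step_dom_pointwise mu h _ nH).
    apply: nnmD; first exact: nnm_potential.
    by apply: nnm_cst; rewrite mulr_ge0.
  move=> x; rewrite potential_pushstep//.
  have : th * (up c (s.1.1 + x) ^+ 2 + down (s.1.2 + x) ^+ 2)
      <= th * (over c (s.1.1 + x) ^+ 2 + over c (s.1.2 + x) ^+ 2).
    rewrite ler_wpM2l// lerD//; apply: lerXn2r; rewrite ?nnegrE ?over_ge0 ?up_ge0 ?down_ge0//.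
      by rewrite /over lerDl down_ge0.
    by rewrite /over lerDr up_ge0.
  rewrite /m; lra.
- have [_ nH _] := H; apply: (step_dom_pointwise mu h nH).
    apply: nnmD.
      apply: nnm_cst; rewrite mulr_ge0 ?expR_ge0//; exact: potential_ge0.
    apply: nnmZ => //; apply: nnmD; last first.
      by apply: nnm_cst; rewrite mulr_ge0 ?sqr_ge0// addr_ge0.
    by apply: nnmZ; [exact: ltW|exact: nnmD].
  move=> x; rewrite /total_over /potential /m /=; lra.
Qed.

(** The matching lower bound, at the price of the overshoots. *)
Lemma potential_step_ge e : 0 < nu -> 0 < e -> exists2 C : R, 0 <= C &
  forall th ka h s, 0 <= th -> 0 <= ka -> 0 < h -> h <= 1 -> admissible c s ->
  step_dom mu h
    (fun=> expR (nu * h) * potential c p q th ka s)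
    (fun x => potential c p q th ka (pushstep c s x)
       + (expR (nu * h) - 1) * moment th ka s.2
       + (upcoef c p q th ka s.2 + downcoef c p q th ka s.2)
         * (e * total_over c (s, x) + C * h ^+ 2)).
Proof.
move=> nu0 e0.
have [C1 C10 C1P] := gstep_up_ge c0 p0 q0 rootp rootq e0.
have [C2 C20 C2P] := gstep_down_ge c0 p0 q0 rootp rootq e0.
exists (C1 + C2); first exact: addr_ge0.
move=> th ka h s th0 ka0 h0 h1 s0; have [a0 ab bc z0] := s0.
have [m0 u0 v0] := coefs_ge0 th0 ka0 z0.
have a1 := le_trans ab bc; have b0 := le_trans a0 ab.
have E0 := expRB1_ge0 nu0 h0.
have Pa : nnm (fun x => over c (s.1.1 + x)) by exact: nnm_over.
have Pb : nnm (fun x => over c (s.1.2 + x)) by exact: nnm_over.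
have gA : step_dom mu h (fun=> expR (nu * h) * A s.1.1)
    (fun x => A (clip c (s.1.1 + x)) + up c (s.1.1 + x)
     + (e * over c (s.1.1 + x) + C1 * h ^+ 2)).
  split; first by apply: nnm_cst; rewrite mulr_ge0 ?expR_ge0.
    by apply: nnmD; [exact: nnm_upstep|exact: nnm_err].
  by rewrite gstep_cst; exact: C1P.
have gD : step_dom mu h (fun=> expR (nu * h) * D s.1.2)
    (fun x => D (clip c (s.1.2 + x)) + down (s.1.2 + x)
     + (e * over c (s.1.2 + x) + C2 * h ^+ 2)).
  split; first by apply: nnm_cst; rewrite mulr_ge0 ?expR_ge0.
    by apply: nnmD; [exact: nnm_downstep|exact: nnm_err].
  by rewrite gstep_cst; exact: C2P.
have Em0 : 0 <= expR (nu * h) * moment th ka s.2 by rewrite mulr_ge0 ?expR_ge0.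
have gm : step_dom mu h (fun=> expR (nu * h) * moment th ka s.2)
    (fun=> expR (nu * h) * moment th ka s.2).
  by apply: step_dom_refl; exact: nnm_cst.
have H := step_domD (step_domD gm (step_domZ u0 gA)) (step_domZ v0 gD).
apply: step_dom_trans (step_dom_trans H _).
- have [nH _ _] := H; apply: (step_dom_pointwise mu h _ nH).
    by apply: nnm_cst; rewrite mulr_ge0 ?expR_ge0//; exact: potential_ge0.
  move=> x; rewrite /potential; lra.
- have [_ nH _] := H; apply: (step_dom_pointwise mu h nH).
    apply: nnmD; first apply: nnmD.
    + exact: nnm_potential.
    + by apply: nnm_cst; rewrite mulr_ge0.
    + apply: nnmZ; first by rewrite addr_ge0.
      apply: nnmD; last by apply: nnm_cst; rewrite mulr_ge0 ?sqr_ge0// addr_ge0.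
      by apply: nnmZ; [exact: ltW|exact: nnmD].
  move=> x; rewrite potential_pushstep// /total_over/=.
  have t0 : 0 <= th * (up c (s.1.1 + x) ^+ 2 + down (s.1.2 + x) ^+ 2).
    by rewrite mulr_ge0// addr_ge0 ?sqr_ge0.
  have oa := Pa.2 x; have ob := Pb.2 x.
  have h20 : 0 <= h ^+ 2 by exact: sqr_ge0.
  have t1 : 0 <= upcoef c p q th ka s.2 * (e * over c (s.1.2 + x) + C2 * h ^+ 2).
    by rewrite mulr_ge0// addr_ge0// mulr_ge0// ltW.
  have t2 : 0 <= downcoef c p q th ka s.2 * (e * over c (s.1.1 + x) + C1 * h ^+ 2).
    by rewrite mulr_ge0// addr_ge0// mulr_ge0// ltW.
  lra.
Qed.

(** The sum of the two values at both walks pays for all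
    overshoots, also those at the ends where nothing is counted. *)
Definition barrier s : R := A s.1.1 + D s.1.1 + (A s.1.2 + D s.1.2).

Lemma barrier_ge0 s : 0 <= barrier s.
Proof. by rewrite /barrier !addr_ge0. Qed.

Lemma barrier_step h s : 0 < h ->
  step_dom mu h (fun x => barrier (pushstep c s x) + total_over c (s, x))
    (fun=> expR (nu * h) * barrier s).
Proof.
move=> h0.
have H := step_domD (step_domD (step_dom_up s.1.1 h0) (step_dom_down s.1.1 h0))
               (step_domD (step_dom_up s.1.2 h0) (step_dom_down s.1.2 h0)).
have [n1 n2 _] := H.
have -> : (fun x => barrier (pushstep c s x) + total_over c (s, x)) = (fun x =>
  A (clip c (s.1.1 + x)) + up c (s.1.1 + x) +
  (D (clip c (s.1.1 + x)) + down (s.1.1 + x)) +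
  (A (clip c (s.1.2 + x)) + up c (s.1.2 + x) +
  (D (clip c (s.1.2 + x)) + down (s.1.2 + x)))).
  by apply/funext => x; rewrite /barrier /total_over /over /=; ring.
have -> : (fun _ : R => expR (nu * h) * barrier s) = (fun _ : R =>
  expR (nu * h) * A s.1.1 + expR (nu * h) * D s.1.1
  + (expR (nu * h) * A s.1.2 + expR (nu * h) * D s.1.2)).
  by apply/funext => x; rewrite /barrier; ring.
by [].
Qed.

Lemma barrier_bounded : exists2 M : R, 0 <= M &
  forall s, admissible c s -> barrier s <= M.
Proof.
pose Abar := (expR (p * c) / p + q^-1) / (expR (p * c) - expR (- (q * c))).
pose Dbar := (expR (q * c) / q + p^-1) / (expR (q * c) - expR (- (p * c))).
have Ale p1 q1 y : 0 < p1 -> 0 < q1 -> 0 <= y -> y <= c -> upvalue c p1 q1 y <=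
    (expR (p1 * c) / p1 + q1^-1) / (expR (p1 * c) - expR (- (q1 * c))).
  move=> p10 q10 y0 yc; rewrite /upvalue ler_wpM2r ?invr_ge0 ?(ltW (upvalue_den _ _ _))//.
  apply: lerD.
    by rewrite ler_wpM2r ?invr_ge0 ?(ltW p10)// ler_expR ler_wpM2l// ltW.
  rewrite -[leRHS]mul1r ler_wpM2r ?invr_ge0 ?(ltW q10)//.
  by rewrite expR_le1 oppr_le0 mulr_ge0// ltW.
have AM y : 0 <= y -> y <= c -> A y <= Abar by exact: Ale.
have DM y : 0 <= y -> y <= c -> D y <= Dbar.
  by move=> y0 yc; apply: Ale; rewrite ?subr_ge0// lerBlDr lerDl.
exists (Abar + Dbar + (Abar + Dbar)) => [|s [a0 ab bc _]].
  have c1 := ltW c0.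
  by rewrite !addr_ge0// ?(le_trans (A0 c) (AM _ _ _)) ?(le_trans (D0 c) (DM _ _ _)).
have a1 := le_trans ab bc; have b0 := le_trans a0 ab.
by apply: lerD; apply: lerD; [apply: AM|apply: DM|apply: AM|apply: DM].
Qed.

(** The product with the accumulated pushing controls the overshoots weighted
    by that pushing. *)
Lemma weighted_barrier_step M h s : 0 <= M ->
  (forall s, admissible c s -> barrier s <= M) -> 0 < h -> admissible c s ->
  step_dom mu h
    (fun x => ((pushstep c s x).2 + M) * barrier (pushstep c s x)
       + s.2 * total_over c (s, x))
    (fun=> expR (nu * h) * ((s.2 + M) * barrier s)).
Proof.
move=> M0 MP h0 s0; have [_ _ _ z0] := s0.
have zM : 0 <= s.2 + M by exact: addr_ge0.
have H := step_domZ zM (barrier_step s h0); have [nH1 nH2 _] := H.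
have -> : (fun _ : R => expR (nu * h) * ((s.2 + M) * barrier s)) =
    (fun _ : R => (s.2 + M) * (expR (nu * h) * barrier s)).
  by apply/funext => x; ring.
apply: step_dom_trans H; apply: (step_dom_pointwise mu h _ nH1).
  apply: nnmD.
    apply: nnmM.
      apply: nnmD; last exact: nnm_cst.
      apply: nnmD; last exact: nnm_down.
      by apply: nnmD; [exact: nnm_cst|exact: nnm_up].
    rewrite /barrier /=; apply: nnmD; apply: nnmD.
    - by apply: nnm_upvalue => //; measurability.
    - by apply: nnm_downvalue => //; measurability.
    - by apply: nnm_upvalue => //; measurability.
    - by apply: nnm_downvalue => //; measurability.
  by apply: nnmZ => //; rewrite /total_over /=; apply: nnmD; exact: nnm_over.
move=> x; have bM := MP _ (admissible_pushstep x c0 s0).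
have b0 := barrier_ge0 (pushstep c s x).
have d0 : up c (s.1.1 + x) + down (s.1.2 + x) <= total_over c (s, x).
  rewrite /total_over /over /=.
  have := down_ge0 (s.1.1 + x); have := up_ge0 c (s.1.2 + x); lra.
have d1 : 0 <= up c (s.1.1 + x) + down (s.1.2 + x).
  by rewrite addr_ge0 ?up_ge0 ?down_ge0.
have h1 : (up c (s.1.1 + x) + down (s.1.2 + x)) * barrier (pushstep c s x)
  <= total_over c (s, x) * M.
  by apply: ler_pM.
have -> : (pushstep c s x).2 = s.2 + (up c (s.1.1 + x) + down (s.1.2 + x)).
  by rewrite /= addrA.
lra.
Qed.

End potential_step.

(** * Truncated variation along a grid *)

Section truncated_variation_of_sequences.
Context {R : realType}.
Variable c : R.
Hypothesis c0 : 0 < c.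
Implicit Types (x : nat -> R) (j : nat -> nat) (n m l : nat) (v : R).

(** Until the sequence has moved by c, the walks record its excess over its
    minimum and its deficit below its maximum: hence a starts at 0, b at c. *)
Fixpoint walk (xi : nat -> R) n : R * R * R :=
  if n is m.+1 then pushstep c (walk xi m) (xi m) else (0, c, 0).

Lemma admissible_walk xi n : admissible c (walk xi n).
Proof.
elim: n => [|n IH] /=; last exact: admissible_pushstep.
by split => //=; exact: ltW.
Qed.

Definition incr x i : R := x i.+1 - x i.

(** The gain of the partition by the first m + 1 terms of a sequence. *)
Definition truncsum x m : R := \sum_(i < m) Num.max (`|x i.+1 - x i| - c) 0.

(** A move of the sequence by more than c is visible in the pushing, as both
    walks stay between 0 and c. *)
Lemma walk_push_ge x m n : (m <= n)%N ->
  Num.max (`|x n - x m| - c) 0 <= (walk (incr x) n).2 - (walk (incr x) m).2.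
Proof.
move=> mn; set w := walk (incr x).
have step k : [/\ (w k).2 <= (w k.+1).2,
    x k.+1 - x k <= (w k.+1).1.1 - (w k).1.1 + ((w k.+1).2 - (w k).2)
    & x k - x k.+1 <= (w k).1.2 - (w k.+1).1.2 + ((w k.+1).2 - (w k).2)].
  rewrite /w /=; case: (walk (incr x) k) => -[a b] z /=; rewrite /incr.
  have u1 := up_ge0 c (a + (x k.+1 - x k)).
  have u2 := down_ge0 (b + (x k.+1 - x k)).
  split; first by lra.
    by move: u1 u2; case: (overshootP (a + _) c0); lra.
  by move: u1 u2; case: (overshootP (b + _) c0); lra.
have [h1 h2 h3] : [/\ (w m).2 <= (w n).2,
    x n - x m <= (w n).1.1 - (w m).1.1 + ((w n).2 - (w m).2)
    & x m - x n <= (w m).1.2 - (w n).1.2 + ((w n).2 - (w m).2)].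
  elim: n mn => [|n IH]; first by rewrite leqn0 => /eqP ->; split; lra.
  rewrite leq_eqVlt => /predU1P[->|/IH[g1 g2 g3]]; first by split; lra.
  by have [k1 k2 k3] := step n; split; lra.
have [k1 k2 k3 _] := admissible_walk (incr x) m.
have [g1 g2 g3 _] := admissible_walk (incr x) n.
rewrite -/(w m) -/(w n) in k1 k2 k3 g1 g2 g3.
rewrite ge_max subr_ge0 h1 andbT lerBlDr ler_norml.
by apply/andP; split; lra.
Qed.

Lemma truncsum_le_walk x j m n : (forall i, (i < m)%N -> (j i <= j i.+1)%N) ->
  (j m <= n)%N -> truncsum (x \o j) m <= (walk (incr x) n).2.
Proof.
move=> jS jn; apply: (@le_trans _ _ (walk (incr x) (j m)).2); last first.
  have := walk_push_ge x jn; have : 0 <= Num.max (`|x n - x (j m)| - c) 0.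
    by rewrite le_max lexx orbT.
  lra.
elim: m jS {n jn} => [|m IH] jS.
  rewrite /truncsum big_ord0; by have [] := admissible_walk (incr x) (j 0%N).
rewrite /truncsum big_ord_recr /=.
have := walk_push_ge x (jS m (ltnSn m)).
have : truncsum (x \o j) m <= (walk (incr x) (j m)).2.
  by apply: IH => i im; apply: jS; rewrite ltnS ltnW.
rewrite /truncsum /=; lra.
Qed.

(** A chain picks increasing indices, the last one being [l]; its gain is at
    least [v]. *)
Definition chain x n v l : Prop := exists m j,
  [/\ forall i, (i < m)%N -> (j i < j i.+1)%N, j m = l, (l <= n)%N
    & v <= truncsum (x \o j) m].

Lemma chainW x n v l : chain x n v l -> chain x n.+1 v l.
Proof. by move=> [m [j [? ? ln ?]]]; exists m, j; split => //; exact: leqW. Qed.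

Lemma chain_le x n v v' l : v' <= v -> chain x n v l -> chain x n v' l.
Proof.
by move=> vv [m [j [? ? ln ?]]]; exists m, j; split => //; exact: le_trans vv _.
Qed.

Lemma chainS x n v l : chain x n v l ->
  chain x n.+1 (v + Num.max (`|x n.+1 - x l| - c) 0) n.+1.
Proof.
move=> [m [j [jS jm ln vle]]].
pose j' i := if (i <= m)%N then j i else n.+1.
exists m.+1, j'; split => //.
- move=> i; rewrite ltnS /j' => im; rewrite im.
  move: im; rewrite leq_eqVlt => /predU1P[->|im]; first by rewrite ltnn jm ltnS.
  by rewrite im jS.
- by rewrite /j' ltnn.
- rewrite /truncsum big_ord_recr /= /j' leqnn ltnn jm lerD2r.
  rewrite (le_trans vle)// /truncsum le_eqVlt; apply/orP; left; apply/eqP.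
  by apply: eq_bigr => i _ /=; rewrite (ltnW (ltn_ord i)) ltn_ord.
Qed.

(** The pushing is attained by chains: [a] records the gain of the best chain
    that is waiting for a maximum, [c - b] that of the best chain that is
    waiting for a minimum. *)
Lemma walk_chain x n : let: (a, b, z) := walk (incr x) n in
  [/\ exists l, chain x n z l,
      exists l, chain x n (z + a - (x n - x l)) l
    & exists l, chain x n (z + c - b - (x l - x n)) l].
Proof.
elim: n => [|n] /=.
  have ch : chain x 0 0 0.
    exists 0%N, (fun=> 0%N); split => //.
    by rewrite /truncsum big_ord0.
  by split; exists 0%N; rewrite ?subrr ?addr0 ?subr0 ?add0r ?subrr//.
have := admissible_walk (incr x) n.
case: (walk _ n) => -[a b] z /= [/= a0 ab bc z0] [[l1 ch1] [l2 ch2] [l3 ch3]].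
have m0 l v : 0 <= Num.max (v - c) 0 by rewrite le_max lexx orbT.
have vm l : `|x n.+1 - x l| - c <= Num.max (`|x n.+1 - x l| - c) 0.
  by rewrite le_max lexx.
have nrm l := ler_norm (x n.+1 - x l).
have nrmN l := ler_norm (x l - x n.+1).
pose xi := incr x n; have xiE : x n.+1 = x n + xi by rewrite /xi /incr; lra.
rewrite -/xi.
have f1 := chainS ch1; have f2 := chainS ch2; have f3 := chainS ch3.
(* A counted push closes the waiting chain at the new value; a walk at the end
   where nothing is counted opens a new one there. *)
case: (overshootP (a + xi) c0) => [a1 a2|a1|a1];
  case: (overshootP (b + xi) c0) => [b1 b2|b1|b1]; try (exfalso; lra).
- split; [exists l1|exists l2|exists l3].
  + by apply: chain_le (chainW ch1); lra.
  + by apply: chain_le (chainW ch2); lra.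
  + by apply: chain_le (chainW ch3); lra.
- split; [exists l1|exists l2|exists n.+1].
  + by apply: chain_le (chainW ch1); lra.
  + by apply: chain_le (chainW ch2); lra.
  + by apply: chain_le f1; have := m0 l1 `|x n.+1 - x l1|; lra.
- split; [exists n.+1|exists l2|exists n.+1].
  + by apply: chain_le f2; have := vm l2; have := nrm l2; lra.
  + by apply: chain_le (chainW ch2); lra.
  + by apply: chain_le f2; have := vm l2; have := nrm l2; lra.
- split; [exists l1|exists n.+1|exists l3].
  + by apply: chain_le (chainW ch1); lra.
  + by apply: chain_le f1; have := m0 l1 `|x n.+1 - x l1|; lra.
  + by apply: chain_le (chainW ch3); lra.
- split; [exists n.+1|exists n.+1|exists l3].
  + by apply: chain_le f3; have := vm l3; have := nrmN l3; rewrite -(normrN (_ - _)) opprB; lra.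
  + by apply: chain_le f3; have := vm l3; have := nrmN l3; rewrite -(normrN (_ - _)) opprB; lra.
  + by apply: chain_le (chainW ch3); lra.
Qed.

End truncated_variation_of_sequences.

(** * Truncated variation of a continuous path *)

Section mesh.
Context {R : realType}.
Implicit Types k : nat.

Definition mesh k : R := 2^-1 ^+ k.

Lemma mesh_gt0 k : 0 < mesh k.
Proof. by rewrite exprn_gt0// invr_gt0. Qed.

Lemma mesh_le1 k : mesh k <= 1.
Proof. by rewrite exprn_ile1// ?invr_ge0// invf_le1// ler1n. Qed.

Lemma mesh_cvg0 : mesh k @[k --> \oo] --> 0.
Proof. by apply: cvg_expr; rewrite ger0_norm ?invr_ge0// invf_lt1// ltr1n. Qed.

End mesh.

Section truncated_variation_of_paths.
Context {R : realType}.
Variable c : R.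
Hypothesis c0 : 0 < c.
Implicit Types (f : R -> R) (h s t : R) (n m k : nat).

Definition grid h f n : R := f (n%:R * h).

Definition gridpush h f n : R := (walk c (incr (grid h f)) n).2.

Lemma gridpush_ge0 h f n : 0 <= gridpush h f n.
Proof. by have [] := admissible_walk c0 (incr (grid h f)) n. Qed.

Lemma truncsum_le_TVc f s (t : nat -> R) n : 0 <= t 0%N ->
  (forall i, (i < n)%N -> t i < t i.+1) -> t n <= s ->
  ((truncsum c (f \o t) n)%:E <= TVc c f s)%E.
Proof. by move=> t0 tS tn; apply: ereal_sup_ubound; exists n, t; split. Qed.

Lemma gridpush_le_TVc h f s n : 0 < h -> n%:R * h <= s ->
  ((gridpush h f n)%:E <= TVc c f s)%E.
Proof.
move=> h0 ns; rewrite /gridpush; have := walk_chain c0 (grid h f) n.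
case: (walk _ _ _) => -[a b] z [[l [m [j [jS jm ln zle]]]] _ _] /=.
apply: (@le_trans _ _ (truncsum c (grid h f \o j) m)%:E); first by rewrite lee_fin.
apply: (@truncsum_le_TVc f s (fun i => (j i)%:R * h)).
- by rewrite mulr_ge0// ltW.
- by move=> i im; rewrite ltr_pM2r// ltr_nat jS.
- by rewrite (le_trans _ ns)// ler_pM2r// ler_nat jm.
Qed.

Let gridpoint t k : R := (Num.truncn (t / mesh k))%:R * mesh k.

Let gridpoint_itv t k : 0 <= t -> 0 <= gridpoint t k <= t /\ t - mesh k <= gridpoint t k.
Proof.
move=> t0; have tm : 0 <= t / mesh k by rewrite divr_ge0// ltW// mesh_gt0.
have /andP[h1 h2] := Num.Theory.truncn_itv tm.
split; last by rewrite lerBlDr -[X in _ + X]mul1r -mulrDl natr1 -ler_pdivrMr ?mesh_gt0// ltW.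
by rewrite mulr_ge0 ?(ltW (mesh_gt0 _))//= -ler_pdivlMr ?mesh_gt0.
Qed.

Let gridpoint_cvg t : 0 <= t -> gridpoint t k @[k --> \oo] --> t.
Proof.
move=> t0; apply: (@squeeze_cvgr _ _ _ _ (fun k => t - mesh k) (fun=> t)).
- by apply: nearW => k; have [/andP[_ ->] ->] := gridpoint_itv k t0.
- rewrite -[X in _ --> X]subr0; apply: cvgB; [exact: cvg_cst|exact: mesh_cvg0].
- exact: cvg_cst.
Qed.

Let f_gridpoint_cvg f t : {within `[0, +oo[, continuous f} -> 0 <= t ->
  f (gridpoint t k) @[k --> \oo] --> f t.
Proof.
move=> /subspace_continuousP cf t0.
have tA : [set` `[(0:R), +oo[] t by rewrite /= in_itv/= t0.
apply: (cvg_comp _ _ _ (cf t tA)) => U tU; rewrite nbhs_simpl /=.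
have H : \forall k \near \oo, [set` `[(0:R), +oo[] (gridpoint t k) ->
    U (gridpoint t k) := gridpoint_cvg t0 tU.
near=> k; have : [set` `[(0:R), +oo[] (gridpoint t k) -> U (gridpoint t k).
  by near: k.
apply; rewrite /=.
by rewrite in_itv /= andbT; have [/andP[]] := gridpoint_itv k t0.
Unshelve. all: by end_near. Qed.

Let truncsum_gridpoint_cvg f (t : nat -> R) n :
  {within `[0, +oo[, continuous f} -> (forall i, (i <= n)%N -> 0 <= t i) ->
  truncsum c (fun i => f (gridpoint (t i) k)) n @[k --> \oo] -->
  truncsum c (f \o t) n.
Proof.
move=> cf; elim: n => [_|n IH tn].
  rewrite /truncsum big_ord0; under eq_fun do rewrite big_ord0.
  exact: cvg_cst.
rewrite /truncsum big_ord_recr /=.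
under eq_fun do rewrite big_ord_recr /=.
apply: cvgD; first by apply: IH => i im; apply: tn; exact: leqW.
have mcts (y : R) : {for y, continuous (fun y : R => Num.max (`|y| - c) 0)}.
  apply: continuous_max; last exact: cvg_cst.
  apply: (@continuousB _ R^o R^o); last exact: cvg_cst.
  exact: norm_continuous.
apply: (cvg_comp (fun k => f (gridpoint (t n.+1) k) - f (gridpoint (t n) k))
  (fun y : R => Num.max (`|y| - c) 0)); last exact: mcts.
by apply: cvgB; apply: f_gridpoint_cvg => //; exact: tn.
Qed.

(** Rounding the times of a partition down to the grid changes its gain
    arbitrarily little, by continuity of the path. *)
Lemma gridpush_cvg f s : {within `[0, +oo[, continuous f} -> 0 <= s ->
  (gridpush (mesh k) f (Num.truncn (s / mesh k)))%:E @[k --> \oo]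
    --> TVc c f s.
Proof.
move=> cf s0; set u := fun k => _.
have u_le k : (u k <= TVc c f s)%E.
  apply: gridpush_le_TVc; first exact: mesh_gt0.
  by have [/andP[]] := gridpoint_itv k s0.
have u_gt M : (M < TVc c f s)%E -> \forall k \near \oo, (M < u k)%E.
  move=> /ereal_sup_gt[_ [n [t [t0 tS tn ->]]] Mt].
  have tge0 : forall i, (i <= n)%N -> 0 <= t i.
    by elim=> // k IH kn; rewrite (le_trans (IH (ltnW kn)))// ltW// tS.
  have leu k : ((truncsum c (fun i => f (gridpoint (t i) k)) n)%:E <= u k)%E.
    rewrite lee_fin.
    apply: (@truncsum_le_walk _ c c0 (grid (mesh k) f) (fun i => Num.truncn (t i / mesh k))).
      move=> i im; apply: Num.Theory.le_truncn; rewrite ler_pM2r ?invr_gt0 ?mesh_gt0//.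
      by rewrite ltW// tS.
    by apply: Num.Theory.le_truncn; rewrite ler_pM2r ?invr_gt0 ?mesh_gt0.
  have := truncsum_gridpoint_cvg cf tge0.
  case: M Mt => [M| |] Mt.
  - move: Mt; rewrite lte_fin => Mt /cvgr_gt/(_ M Mt); apply: filterS => k Mk.
    by rewrite (lt_le_trans _ (leu k))// lte_fin.
  - by move: Mt; rewrite ltNge leey.
  - by move=> _; apply: nearW => k; rewrite (lt_le_trans _ (leu k))// ltNyr.
have T0 : (0 <= TVc c f s)%E.
  by apply: le_trans (u_le 0%N); rewrite lee_fin gridpush_ge0.
case TE : (TVc c f s) T0 => [T| |//] T0; last first.
  apply/cvgeyPge => M; have := u_gt M%:E; rewrite TE ltry => /(_ isT).
  by apply: filterS => k /ltW.
apply/fine_cvgP; split; first exact: nearW.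
apply/cvgrPdist_lt => e e0; have := u_gt (T - e)%:E.
rewrite TE lte_fin ltrBlDr ltrDl => /(_ e0); apply: filterS => k.
rewrite /u lte_fin /= => h1; have := u_le k; rewrite /u TE lee_fin => h2.
by rewrite ger0_norm ?subr_ge0// ltrBlDr -ltrBlDl.
Qed.

End truncated_variation_of_paths.

(** * Independence *)

Section independence.
Context d (T : measurableType d) (R : realType) (P : probability T R).

(** Integration against independent variables, in the order of Tonelli. *)
Lemma ge0_integral_indep d1 d2 (T1 : measurableType d1)
    (T2 : measurableType d2) (m : probability T2 R) (X : T -> T1) (Y : T -> T2)
    (f : T1 * T2 -> \bar R) :
  measurable_fun setT X -> measurable_fun setT Y ->
  (forall A B, measurable A -> measurable B ->
     P (X @^-1` A `&` Y @^-1` B) = (P (X @^-1` A) * m B)%E) ->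
  measurable_fun setT f -> (forall xy, 0 <= f xy)%E ->
  (\int[P]_w f (X w, Y w) = \int[P]_w \int[m]_y f (X w, y))%E.
Proof.
move=> mX mY XY mf f0.
pose X' : {mfun T >-> T1} := HB.pack X (isMeasurableFun.Build _ _ _ _ X mX).
have mXY : measurable_fun setT (fun w => (X w, Y w)).
  exact: measurable_fun_pair.
pose XY' : {mfun T >-> (T1 * T2)%type} :=
  HB.pack (fun w => (X w, Y w)) (isMeasurableFun.Build _ _ _ _ _ mXY).
have -> : (\int[P]_w f (X w, Y w) = \int[distribution P XY']_z f z)%E.
  by rewrite ge0_integral_pushforward.
rewrite (eq_measure_integral (distribution P X' \x m)%E); last first.
  by move=> A mA _; apply/esym; exact: product_measure_unique.
rewrite fubini_tonelli1//.
rewrite ge0_integral_pushforward//; first exact: measurable_fun_fubini_tonelli_F.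
by move=> y _; apply: integral_ge0.
Qed.

Lemma measurable_generated (G : set (set T)) (X : T -> R) :
  (forall A, measurable A -> G (X @^-1` A)) ->
  measurable_fun (setT : set (g_sigma_algebraType G)) X.
Proof.
by move=> GX _ A mA; rewrite setTI; apply: sub_sigma_algebra; exact: GX.
Qed.

(** Independence of a set from a system closed under intersections extends to
    the generated sigma-algebra. *)
Lemma indep_generated (G : set (set T)) (F : set T) :
  G `<=` measurable -> setI_closed G -> G setT -> measurable F ->
  (forall E, G E -> P (E `&` F) = (P E * P F)%E) ->
  forall E, <<s G >> E -> P (E `&` F) = (P E * P F)%E.
Proof.
move=> Gm GI GT mF GF E sE.
have PF0 : 0 <= fine (P F) by rewrite fine_ge0.
have PFE : ((fine (P F))%:E = P F)%E by rewrite fineK// fin_num_measure.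
have scaleE A : mscale (NngNum PF0) P A = (P A * P F)%E.
  by rewrite /mscale/= PFE muleC.
have := @g_sigma_algebra_measure_unique _ R T G Gm (fun=> setT) (fun=> GT) _
  (mrestr P mF) (mscale (NngNum PF0) P) GI _ _ E sE.
move=> H; rewrite -scaleE; apply: H.
- by rewrite bigcup_const.
- by move=> A GA; transitivity (P A * P F)%E; [exact: GF|exact/esym/scaleE].
- by move=> _; rewrite /= /mrestr setTI (le_lt_trans (probability_le1 P mF))// ltry.
Qed.

End independence.

Section walk_measurability.
Context d (T : measurableType d) (R : realType).

Lemma measurable_walk (c : R) (xi : nat -> T -> R) n :
  (forall i, (i < n)%N -> measurable_fun setT (xi i)) ->
  measurable_fun setT (fun w => walk c (xi ^~ w) n).
Proof.
elim: n => [|n IH] mxi /=; first exact: measurable_cst.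
have mw : measurable_fun setT (fun w => (walk c (xi ^~ w) n, xi n w)).
  apply: measurable_fun_pair; last exact: mxi.
  by apply: IH => i im; apply: mxi; exact: leqW.
exact: (measurableT_comp (measurable_pushstep c) mw).
Qed.

End walk_measurability.

Section brownian_walk.
Context d (T : measurableType d) (R : realType) (P : probability T R).
Variables (B : R -> {RV P >-> R}) (mu c h : R).
Hypotheses (BM : standard_brownian_motion B) (c0 : 0 < c) (h0 : 0 < h).
Local Notation W := (bm_with_drift B mu).

Definition brownian_incr n (w : T) : R := incr (grid h (W ^~ w)) n.

Definition brownian_walk n (w : T) : R * R * R :=
  walk c (fun i => brownian_incr i w) n.

Local Notation xi := brownian_incr.
Local Notation X := brownian_walk.

Let t i : R := i%:R * h.

Let dB i w : R := B (t i.+1) w - B (t i) w.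

Let t_lt i : t i < t i.+1.
Proof. by rewrite ltr_pM2r// ltr_nat. Qed.

Let t_ge0 i : 0 <= t i.
Proof. by rewrite mulr_ge0// ltW. Qed.

Let tS i : t i.+1 - t i = h.
Proof. by rewrite /t -natr1 mulrDl mul1r addrC addKr. Qed.

Let mdB i : measurable_fun setT (dB i).
Proof. by apply: measurable_funB; exact: measurable_funP. Qed.

Let xiE i w : xi i w = dB i w + mu * h.
Proof. by rewrite /xi /incr /grid /bm_with_drift -/(t _) -/(t _) -(tS i) /dB; ring. Qed.

Lemma measurable_brownian_incr i : measurable_fun setT (xi i).
Proof.
rewrite (_ : xi i = fun w => dB i w + mu * h); last first.
  by apply/funext => w; exact: xiE.
by have mi := mdB i; measurability.
Qed.

Lemma measurable_brownian_walk n : measurable_fun setT (X n).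
Proof. by apply: measurable_walk => i _; exact: measurable_brownian_incr. Qed.

Let shift_measurable (A : set R) : measurable A ->
  measurable [set y : R | A (y + mu * h)].
Proof.
move=> mA; have := @measurable_funD _ R R setT id (cst (mu * h)).
move=> /(_ (@measurable_id _ _ _) (@measurable_cst _ _ _ _ _ _)).
by move=> /(_ measurableT _ mA); rewrite setTI.
Qed.

Let indep_incr n (A : nat -> set R) : (forall i, measurable (A i)) ->
  P (\bigcap_(i < n) (xi i @^-1` A i)) = (\prod_(i < n) P (xi i @^-1` A i))%E.
Proof.
move=> mA.
have H := bm_independent_increments BM (t_ge0 0%N) (fun i (_ : (i < n)%N) => t_lt i).
have := H (fun i => [set y | A i (y + mu * h)]) (fun i => shift_measurable (mA i)).
have E (i : nat) : xi i @^-1` A i =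
    (fun w => B (t i.+1) w - B (t i) w) @^-1` [set y | A i (y + mu * h)].
  by apply/seteqP; split => w /=; rewrite xiE.
under [in X in _ = X -> _]eq_bigr => i _ do rewrite -E.
move=> <-; congr (P _); apply/seteqP; split => w /= Hw i.
  by move=> _; rewrite -E; exact: (Hw i (ltn_ord i)).
by move=> im; have := Hw (Ordinal im) Logic.I; rewrite -E.
Qed.

(* The cylinder sets of the first n increments. *)
Let cyl n : set (set T) := [set E | exists A : nat -> set R,
  (forall i, measurable (A i)) /\ E = \bigcap_(i < n) (xi i @^-1` A i)].

Let mxi_pre i (A : set R) : measurable A -> measurable (xi i @^-1` A).
Proof.
by move=> mA; rewrite -[X in measurable X]setTI; exact: measurable_brownian_incr.
Qed.

(** The walk up to time [n] is independent of the next increment. *)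
Lemma brownian_walk_indep n (A : set (R * R * R)) (A' : set R) :
  measurable A -> measurable A' ->
  P (X n @^-1` A `&` xi n @^-1` A') = (P (X n @^-1` A) * P (xi n @^-1` A'))%E.
Proof.
move=> mA mA'.
apply: (@indep_generated _ _ _ _ (cyl n)).
- move=> _ [A1 [mA1 ->]]; apply: bigcap_measurableType => i _; exact: mxi_pre.
- move=> _ _ [A1 [mA1 ->]] [A2 [mA2 ->]]; exists (fun i => A1 i `&` A2 i).
  split; first by move=> i; exact: measurableI.
  apply/seteqP; split => w /=.
    by move=> [H1 H2] i im; split; [exact: H1|exact: H2].
  by move=> H; split => i im; have [] := H i im.
- exists (fun=> setT); split => //; apply/seteqP; split => //.
- exact: mxi_pre.
- move=> _ [A1 [mA1 ->]].
  pose A2 i := if (i < n)%N then A1 i else A'.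
  have mA2 i : measurable (A2 i) by rewrite /A2; case: ifP.
  have -> : \bigcap_(i < n) (xi i @^-1` A1 i) `&` xi n @^-1` A' =
      \bigcap_(i < n.+1) (xi i @^-1` A2 i).
    apply/seteqP; split => w /=.
      move=> [H1 H2] i; rewrite /= ltnS leq_eqVlt => /predU1P[->|im].
        by rewrite /A2 ltnn.
      by rewrite /A2 im; exact: H1.
    move=> H; split => [i im|]; last by have := H n (ltnSn n); rewrite /A2 ltnn.
    by have := H i (leqW im); rewrite /A2 im.
  rewrite !indep_incr// big_ord_recr /= /A2 ltnn; congr (_ * _)%E.
  by apply: eq_bigr => i _; rewrite ltn_ord.
- have : measurable_fun (setT : set (g_sigma_algebraType (cyl n)))
      (fun w => walk c (fun i => xi i w) n).
    apply: measurable_walk => i im; apply: measurable_generated => A1 mA1.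
    exists (fun j => if j == i then A1 else setT); split.
      by move=> j; case: ifP.
    apply/seteqP; split => w /=.
      by move=> Hw j jm /=; case: eqP => // ->.
    by move=> /(_ i im) /=; rewrite eqxx.
  by move=> /(_ measurableT _ mA); rewrite setTI.
Qed.

Let law_dB i (A : set R) : measurable A ->
  P (dB i @^-1` A) = normal_prob 0 (Num.sqrt h) A.
Proof.
by move=> mA; rewrite -(tS i); apply: (bm_gaussian_increments BM).
Qed.

(** Averaging over the next increment, given the walk. *)
Lemma rint_brownian_walk n (f : (R * R * R) * R -> R) : nnm f ->
  rint P (fun w => f (X n w, xi n w))
  = (\int[P]_w gstep mu h (fun x => f (X n w, x)))%E.
Proof.
move=> [mf f0].
have mfs : measurable_fun [set: (R * R * R) * R] (fun z => f (z.1, z.2 + mu * h)).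
  apply: (measurableT_comp mf); apply: measurable_fun_pair; measurability.
transitivity (rint P (fun w => f (X n w, dB n w + mu * h))).
  by congr rint; apply/funext => w; rewrite xiE.
pose F (z : (R * R * R) * R) : \bar R := (f (z.1, z.2 + mu * h))%:E.
transitivity (\int[P]_w F (X n w, dB n w))%E; first by [].
transitivity (\int[P]_w \int[normal_prob 0 (Num.sqrt h)]_y F (X n w, y))%E;
  last by [].
apply: (@ge0_integral_indep _ _ _ P _ _ _ _ (normal_prob 0 (Num.sqrt h))
  (X n) (dB n) F).
- exact: measurable_brownian_walk.
- exact: mdB.
- move=> A A' mA mA'.
  have -> : dB n @^-1` A' = xi n @^-1` [set y | A' (y - mu * h)].
    by apply/seteqP; split => w /=; rewrite xiE addrK.
  have mA2 : measurable [set y : R | A' (y - mu * h)].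
    have := @measurable_funB _ R R setT id (cst (mu * h)).
    move=> /(_ (@measurable_id _ _ _) (@measurable_cst _ _ _ _ _ _)).
    by move=> /(_ measurableT _ mA'); rewrite setTI.
  rewrite brownian_walk_indep//; congr (_ * _)%E.
  transitivity (P (dB n @^-1` A')); last exact: law_dB.
  by congr (P _); apply/seteqP; split => w /=; rewrite xiE addrK.
- exact/measurable_EFinP.
- by move=> z; rewrite lee_fin.
Qed.

Lemma admissible_brownian_walk n w : admissible c (X n w).
Proof. exact: admissible_walk. Qed.

(** Domination of the means for all admissible states carries over to the
    walk. *)
Lemma rint_brownian_walk_le n (f g : (R * R * R) * R -> R) : nnm f -> nnm g ->
  (forall s, admissible c s ->
     step_dom mu h (fun x => f (s, x)) (fun x => g (s, x))) ->
  (rint P (fun w => f (X n w, xi n w)) <= rint P (fun w => g (X n w, xi n w)))%E.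
Proof.
move=> nf ng fg; rewrite !rint_brownian_walk//.
have mG (k : (R * R * R) * R -> R) : nnm k ->
    measurable_fun setT (fun w => gstep mu h (fun x => k (X n w, x))).
  move=> [mk k0].
  have mks : measurable_fun [set: (R * R * R) * R] (fun z => (k (z.1, z.2 + mu * h))%:E).
    apply/measurable_EFinP.
    by apply: (measurableT_comp mk); apply: measurable_fun_pair; measurability.
  have k0' z : (0 <= (k (z.1, z.2 + mu * h)%R)%:E)%E by rewrite lee_fin.
  have := @measurable_fun_fubini_tonelli_F _ _ _ _ R
    (normal_prob 0 (Num.sqrt h)) _ mks k0'.
  by move=> mF; apply: (measurableT_comp mF); exact: measurable_brownian_walk.
apply: ge0_le_integral => //.
- by move=> w _; apply: gstep_ge0 => x; exact: nf.2.
- exact: mG.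
- exact: mG.
- move=> w _; have [_ _] := fg _ (admissible_brownian_walk n w); exact.
Qed.

End brownian_walk.

(** * Discounted sums of moments of the pushing *)

Section expectation.
Context d (T : measurableType d) (R : realType) (P : probability T R).
Implicit Types f g : T -> R.

Definition integ f := nnm f /\ (rint P f < +oo)%E.

Definition mean f : R := fine (rint P f).

Lemma meanE f : integ f -> rint P f = (mean f)%:E.
Proof.
by move=> [[mf f0] fy]; rewrite fineK// ge0_fin_numE//; exact: rint_ge0.
Qed.

Lemma mean_ge0 f : nnm f -> 0 <= mean f.
Proof. by move=> [mf f0]; apply: fine_ge0; exact: rint_ge0. Qed.

Lemma integ_cst k : 0 <= k -> integ (fun=> k).
Proof. by move=> k0; split; [exact: nnm_cst|rewrite rint_cst ltry]. Qed.

Lemma mean_cst k : mean (fun=> k) = k.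
Proof. by rewrite /mean rint_cst. Qed.

Lemma integ_rle f g : nnm f -> integ g -> (rint P f <= rint P g)%E ->
  integ f /\ mean f <= mean g.
Proof.
move=> nf ig fg; have fi : integ f by split=> //; exact: le_lt_trans fg ig.2.
by split=> //; rewrite -lee_fin -!meanE.
Qed.

Lemma integ_le f g : nnm f -> integ g -> (forall x, f x <= g x) ->
  integ f /\ mean f <= mean g.
Proof.
move=> nf ig fg; apply: integ_rle => //.
by apply: le_rint => //; [exact: nf.1|exact: ig.1.1|exact: nf.2].
Qed.

Lemma integD f g : integ f -> integ g -> integ (fun x => f x + g x).
Proof.
move=> [[mf f0] fy] [[mg g0] gy]; split; first exact: nnmD.
by rewrite rintD// lte_add_pinfty.
Qed.

Lemma meanD f g : integ f -> integ g -> mean (fun x => f x + g x) = mean f + mean g.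
Proof.
move=> fi gi; apply: EFin_inj; rewrite EFinD -!meanE//; last exact: integD.
by rewrite rintD//; [exact: fi.1.1|exact: gi.1.1|exact: fi.1.2|exact: gi.1.2].
Qed.

Lemma integZ k f : 0 <= k -> integ f -> integ (fun x => k * f x).
Proof.
move=> k0 fi; split; first exact: nnmZ fi.1.
rewrite rintZ//; [|exact: fi.1.1|exact: fi.1.2].
by rewrite meanE// -EFinM ltry.
Qed.

Lemma meanZ k f : 0 <= k -> integ f -> mean (fun x => k * f x) = k * mean f.
Proof.
move=> k0 fi; apply: EFin_inj; rewrite EFinM -!meanE//; last exact: integZ.
by rewrite rintZ//; [exact: fi.1.1|exact: fi.1.2].
Qed.

End expectation.

Section discounting.
Context {R : realType}.
Variables E r : R.
Hypotheses (r0 : 0 < r) (rE : r * E = 1).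
Implicit Types e g k : nat -> R.

(** The weights telescope when one step multiplies the mean by at most [E],
    the inverse of [r]. *)
Definition discsum g N : R := \sum_(n < N) r ^+ n.+1 * g n.

Lemma discsumD g k N : discsum (fun n => g n + k n) N = discsum g N + discsum k N.
Proof. by rewrite -big_split; apply: eq_bigr => n _; rewrite mulrDr. Qed.

Lemma discsumZ a g N : discsum (fun n => a * g n) N = a * discsum g N.
Proof. by rewrite mulr_sumr; apply: eq_bigr => n _; rewrite mulrCA. Qed.

Lemma discsum_ge0 g N : (forall n, 0 <= g n) -> 0 <= discsum g N.
Proof. by move=> g0; apply: sumr_ge0 => n _; rewrite mulr_ge0// exprn_ge0// ltW. Qed.

Lemma discsum_super e g k : (forall n, e n.+1 + g n <= E * e n + k n) ->
  forall N, r ^+ N * e N + discsum g N <= e 0%N + discsum k N.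
Proof.
move=> H; elim=> [|N IH]; first by rewrite expr0 mul1r /discsum !big_ord0.
rewrite /discsum !big_ord_recr/= -/(discsum g N) -/(discsum k N).
have rN : 0 <= r ^+ N.+1 by rewrite exprn_ge0// ltW.
have := ler_wpM2l rN (H N); rewrite !mulrDr.
have -> : r ^+ N.+1 * (E * e N) = r ^+ N * e N.
  by rewrite exprSr mulrA -(mulrA (r ^+ N)) rE mulr1.
lra.
Qed.

Lemma discsum_sub e g : (forall n, E * e n <= e n.+1 + g n) ->
  forall N, e 0%N <= r ^+ N * e N + discsum g N.
Proof.
move=> H; elim=> [|N IH]; first by rewrite expr0 mul1r /discsum big_ord0 addr0.
rewrite /discsum !big_ord_recr/= -/(discsum g N).
have rN : 0 <= r ^+ N.+1 by rewrite exprn_ge0// ltW.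
have := ler_wpM2l rN (H N); rewrite !mulrDr.
have -> : r ^+ N.+1 * (E * e N) = r ^+ N * e N.
  by rewrite exprSr mulrA -(mulrA (r ^+ N)) rE mulr1.
lra.
Qed.

(** Otherwise the partial sums would grow linearly. *)
Lemma discsum_tail g M : (forall n, 0 <= g n) -> (forall N, discsum g N <= M) ->
  forall eps : R, 0 < eps -> exists N, r ^+ N * g N <= eps.
Proof.
move=> g0 gM e e0; apply: contrapT => /forallNP H.
have {}H n : e < r ^+ n * g n by rewrite ltNge; apply/negP; exact: H.
have lb N : N%:R * (r * e) <= discsum g N.
  elim: N => [|N IH]; first by rewrite mul0r /discsum big_ord0.
  rewrite /discsum big_ord_recr/= -/(discsum g N) -natr1 mulrDl mul1r lerD//.
  by rewrite exprS -mulrA ler_wpM2l ?(ltW r0)// ltW.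
have re : 0 < r * e by rewrite mulr_gt0.
have := le_trans (lb (Num.truncn (M / (r * e))).+1) (gM _).
rewrite -ler_pdivlMr// leNgt => /negP; apply.
exact: Num.Theory.truncnS_gt.
Qed.

End discounting.

Section discounted_moments.
Context d (T : measurableType d) (R : realType) (P : probability T R).
Variables (B : R -> {RV P >-> R}) (mu c nu p q : R).
Hypotheses (BM : standard_brownian_motion B) (c0 : 0 < c) (nu0 : 0 < nu).
Hypotheses (p0 : 0 < p) (q0 : 0 < q).
Hypotheses (rootp : p * mu + p ^+ 2 / 2 = nu)
  (rootq : - q * mu + q ^+ 2 / 2 = nu).
Implicit Types (h e th ka : R) (n N : nat).

Local Notation X h := (brownian_walk B mu c h).
Local Notation xi h := (brownian_incr B mu h).
Local Notation len h n := (fun w => total_over c (X h n w, xi h n w)).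
Local Notation z h n := (fun w => (X h n w).2).
Local Notation E h := (expR (nu * h)).
Local Notation r h := (expR (- (nu * h))).

Let rE h : r h * E h = 1.
Proof. by rewrite mulrC expRxMexpNx_1. Qed.

Let E1 h : 0 < h -> nu * h <= E h - 1.
Proof. by move=> h0; rewrite lerBrDl expR_ge1Dx. Qed.

Let mXxi h n : 0 < h -> measurable_fun setT (fun w => (X h n w, xi h n w)).
Proof.
move=> h0; apply: measurable_fun_pair; first exact: measurable_brownian_walk.
exact: measurable_brownian_incr.
Qed.

(* Only admissible states matter, so that f and g may be truncated at 0. *)
Let transfer h n (f g : (R * R * R) * R -> R) : 0 < h ->
  measurable_fun setT f -> measurable_fun setT g ->
  (forall s, admissible c s ->
     step_dom mu h (fun x => f (s, x)) (fun x => g (s, x))) ->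
  integ P (fun w => g (X h n w, xi h n w)) ->
  integ P (fun w => f (X h n w, xi h n w)) /\
  mean P (fun w => f (X h n w, xi h n w)) <= mean P (fun w => g (X h n w, xi h n w)).
Proof.
move=> h0 mf mg fg.
have trunc (k : (R * R * R) * R -> R) : measurable_fun setT k ->
    nnm (fun sx => Num.max 0 (k sx)).
  move=> mk; split=> [|sx]; last by rewrite le_max lexx.
  by apply: measurable_maxr => //; exact: measurable_cst.
have fE s : admissible c s -> (fun x => Num.max 0 (f (s, x))) = fun x => f (s, x).
  move=> /fg[[_ fs0] _ _]; apply/funext => x; exact: max_r.
have gE s : admissible c s -> (fun x => Num.max 0 (g (s, x))) = fun x => g (s, x).
  move=> /fg[_ [_ gs0] _]; apply/funext => x; exact: max_r.
have XE (k : (R * R * R) * R -> R) :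
    (forall s, admissible c s -> (fun x => Num.max 0 (k (s, x))) = fun x => k (s, x)) ->
    (fun w => k (X h n w, xi h n w)) =
    (fun w => (fun sx => Num.max 0 (k sx)) (X h n w, xi h n w)).
  move=> kE; apply/funext => w /=.
  have := kE _ (admissible_brownian_walk B mu h c0 n w).
  by move=> /(congr1 (fun F => F (xi h n w))).
rewrite (XE f)// (XE g)// => ig; apply: integ_rle => //.
  exact: (nnm_comp (trunc _ mf) (mXxi n h0)).
apply: (rint_brownian_walk_le BM c0 h0 n (trunc _ mf) (trunc _ mg)).
by move=> s s0; rewrite fE// gE//; exact: fg.
Qed.

Lemma measurable_barrier : measurable_fun [set: R * R * R] (barrier c p q).
Proof. by rewrite /barrier; measurability. Qed.

Lemma measurable_total_over : measurable_fun [set: (R * R * R) * R] (total_over c).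
Proof. by rewrite /total_over; measurability. Qed.

Lemma measurable_potential th ka :
  measurable_fun [set: R * R * R] (potential c p q th ka).
Proof.
by rewrite /potential /moment /upcoef /downcoef; measurability.
Qed.

Let mfst (f : R * R * R -> R) : measurable_fun setT f ->
  measurable_fun [set: (R * R * R) * R] (fun sx => f sx.1).
Proof. by move=> mf; apply: (measurableT_comp mf); exact: measurable_fst. Qed.

Let mstep (f : R * R * R -> R) : measurable_fun setT f ->
  measurable_fun [set: (R * R * R) * R] (fun sx => f (pushstep c sx.1 sx.2)).
Proof. by move=> mf; apply: (measurableT_comp mf); exact: measurable_pushstep. Qed.

Let nnm_walk h n (f : R * R * R -> R) : 0 < h -> measurable_fun setT f ->
  (forall s, admissible c s -> 0 <= f s) -> nnm (fun w => f (X h n w)).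
Proof.
move=> h0 mf f0; split.
  by apply: (measurableT_comp mf); exact: measurable_brownian_walk.
by move=> w; apply: f0; exact: admissible_brownian_walk.
Qed.

Let nnm_len h n : 0 < h -> nnm (len h n).
Proof.
move=> h0; split; first exact: (measurableT_comp measurable_total_over (mXxi n h0)).
by move=> w; rewrite /total_over addr_ge0 ?over_ge0.
Qed.

Let nnm_z h n : 0 < h -> nnm (z h n).
Proof.
by move=> h0; apply: (@nnm_walk h n snd h0 (@measurable_snd _ _ _ _)) => s [].
Qed.

Let s0 : R * R * R := (0, c, 0).

Local Notation bar h n := (fun w => barrier c p q (X h n w)).

Let bar_ge0 s : 0 <= barrier c p q s. Proof. exact: barrier_ge0. Qed.

Let integ_bar h n : 0 < h -> integ P (bar h n).
Proof.
move=> h0; have [M M0 MP] := barrier_bounded c0 p0 q0.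
have nb : nnm (bar h n) by apply: nnm_walk => //; exact: measurable_barrier.
have le w : bar h n w <= M by apply: MP; exact: admissible_brownian_walk.
by have [] := integ_le nb (integ_cst P M0) le.
Qed.

Let bar_rec h n : 0 < h -> integ P (len h n) /\
  mean P (bar h n.+1) + mean P (len h n) <= E h * mean P (bar h n).
Proof.
move=> h0.
pose f sx := barrier c p q (pushstep c sx.1 sx.2) + total_over c sx.
have mf : measurable_fun [set: (R * R * R) * R] f.
  apply: measurable_funD; last exact: measurable_total_over.
  by apply: mstep; exact: measurable_barrier.
have mg : measurable_fun [set: (R * R * R) * R]
    (fun sx => E h * barrier c p q sx.1).
  apply: measurable_funM; first exact: measurable_cst.
  by apply: mfst; exact: measurable_barrier.
have [|Hf He] := transfer (n := n) h0 mf mg (fun s _ => barrier_step c0 p0 q0 rootp rootq s h0).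
  by apply: integZ; [exact: expR_ge0|exact: integ_bar].
have [lenI _] : integ P (len h n) /\ mean P (len h n) <= mean P (fun w => f (X h n w, xi h n w)).
  apply: integ_le => //; first exact: nnm_len.
  by move=> w; rewrite lerDr.
split=> //.
have := meanD (integ_bar n.+1 h0) lenI.
rewrite -(meanZ (expR_ge0 _) (integ_bar n h0)) => <-.
exact: He.
Qed.

(* The weight is z + M rather than z: the change of z in one step is multiplied
   by a barrier, which M bounds. *)
Let wbar_rec M h : 0 <= M -> (forall s, admissible c s -> barrier c p q s <= M) ->
  0 < h -> forall n, let wbar k := (fun w => (z h k w + M) * bar h k w) in
  [/\ integ P (wbar n), integ P (fun w => z h n w * len h n w)
    & mean P (wbar n.+1) + mean P (fun w => z h n w * len h n w) <= E h * mean P (wbar n)].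
Proof.
move=> M0 MP h0 n wbar.
pose G (s : R * R * R) := (s.2 + M) * barrier c p q s.
have mG : measurable_fun setT G.
  apply: measurable_funM; last exact: measurable_barrier.
  by measurability.
have G0 s : admissible c s -> 0 <= G s.
  by move=> [_ _ _ z0]; rewrite mulr_ge0// addr_ge0.
pose f (sx : (R * R * R) * R) := G (pushstep c sx.1 sx.2) + sx.1.2 * total_over c sx.
have mf : measurable_fun setT f.
  apply: measurable_funD; first exact: mstep.
  by apply: measurable_funM; [measurability | exact: measurable_total_over].
have mg : measurable_fun [set: (R * R * R) * R] (fun sx => E h * G sx.1).
  by apply: measurable_funM; [exact: measurable_cst | exact: mfst].
have nG k : nnm (wbar k) := @nnm_walk h k G h0 mG G0.
have nzl k : nnm (fun w => z h k w * len h k w).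
  by apply: nnmM; [exact: nnm_z|exact: nnm_len].
have step k : integ P (wbar k) -> [/\ integ P (wbar k.+1),
   integ P (fun w => z h k w * len h k w)
   & mean P (wbar k.+1) + mean P (fun w => z h k w * len h k w) <= E h * mean P (wbar k)].
  move=> ik.
  have [|Hf He] := transfer (n := k) h0 mf mg
    (fun s sa => weighted_barrier_step c0 p0 q0 rootp rootq M0 MP h0 sa).
    by apply: integZ; [exact: expR_ge0|].
  have [i1 _] : integ P (wbar k.+1) /\ mean P (wbar k.+1) <= mean P (fun w => f (X h k w, xi h k w)).
    by apply: integ_le => // w; rewrite lerDl; exact: (nzl k).2.
  have [i2 _] : integ P (fun w => z h k w * len h k w) /\
      mean P (fun w => z h k w * len h k w) <= mean P (fun w => f (X h k w, xi h k w)).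
    by apply: integ_le => // w; rewrite lerDr; exact: (nG k.+1).2.
  split=> //; rewrite -meanD// -meanZ ?expR_ge0//; exact: He.
have ik k : integ P (wbar k).
  elim: k => [|k /step[]//].
  exact: (integ_cst P (G0 s0 (admissible_brownian_walk B mu h c0 0 point))).
by have [] := step n (ik n).
Qed.

Local Notation pot th ka h n := (fun w => potential c p q th ka (X h n w)).
Local Notation mom th ka h n := (fun w => moment th ka (z h n w)).

Let nnm_pot th ka h n : 0 <= th -> 0 <= ka -> 0 < h -> nnm (pot th ka h n).
Proof.
move=> th0 ka0 h0; apply: (@nnm_walk h n _ h0 (measurable_potential th ka)).
by move=> s [_ _ _ z0]; exact: potential_ge0.
Qed.

Let nnm_mom th ka h n : 0 <= th -> 0 <= ka -> 0 < h -> nnm (mom th ka h n).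
Proof.
move=> th0 ka0 h0; apply: (@nnm_walk h n (fun s => moment th ka s.2) h0).
  by rewrite /moment; measurability.
by move=> s [_ _ _ z0]; exact: moment_ge0.
Qed.

Let E1_ge0 h : 0 < h -> 0 <= E h - 1.
Proof. by move=> h0; rewrite (le_trans _ (E1 h0))// mulr_ge0// ltW. Qed.

Let pot_up e : 0 < e -> exists2 C : R, 0 <= C &
  forall th ka h, 0 <= th -> 0 <= ka -> 0 < h -> h <= 1 -> forall n,
  [/\ integ P (pot th ka h n), integ P (mom th ka h n)
    & mean P (pot th ka h n.+1) + (E h - 1) * mean P (mom th ka h n)
      <= E h * mean P (pot th ka h n) + th * (e * mean P (len h n) + C * h ^+ 2)].
Proof.
move=> e0.
have [C C0 CP] := potential_step_le c0 p0 q0 rootp rootq nu0 e0.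
exists C => // th ka h th0 ka0 h0 h1.
have Eh0 := E1_ge0 h0.
have h20 : 0 <= h ^+ 2 by exact: sqr_ge0.
pose f (sx : (R * R * R) * R) := potential c p q th ka (pushstep c sx.1 sx.2)
  + (E h - 1) * moment th ka sx.1.2.
pose g (sx : (R * R * R) * R) := E h * potential c p q th ka sx.1
  + th * (e * total_over c sx + C * h ^+ 2).
have mf : measurable_fun setT f.
  apply: measurable_funD; first by apply: mstep; exact: measurable_potential.
  by rewrite /moment; measurability.
have mg : measurable_fun setT g.
  apply: measurable_funD.
    apply: measurable_funM; first exact: measurable_cst.
    by apply: mfst; exact: measurable_potential.
  apply: measurable_funM; first exact: measurable_cst.
  apply: measurable_funD; last exact: measurable_cst.
  by apply: measurable_funM; [exact: measurable_cst|exact: measurable_total_over].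
have np k := @nnm_pot th ka h k th0 ka0 h0.
have nm k := @nnm_mom th ka h k th0 ka0 h0.
have step k : integ P (pot th ka h k) ->
  [/\ integ P (pot th ka h k.+1), integ P (mom th ka h k)
    & mean P (pot th ka h k.+1) + (E h - 1) * mean P (mom th ka h k)
      <= E h * mean P (pot th ka h k) + th * (e * mean P (len h k) + C * h ^+ 2)].
  move=> ik; have [il _] := bar_rec k h0.
  have ie : integ P (fun w => e * len h k w + C * h ^+ 2).
    by apply: integD; [apply: integZ => //; exact: ltW|apply: integ_cst; exact: mulr_ge0].
  have iE : integ P (fun w => E h * pot th ka h k w).
    by apply: integZ => //; exact: expR_ge0.
  have ig : integ P (fun w => g (X h k w, xi h k w)).
    by apply: integD => //; exact: integZ.
  have [Hf He] := transfer (n := k) h0 mf mg (fun s sa => CP th ka h s th0 ka0 h0 h1 sa) ig.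
  have [i1 _] : integ P (pot th ka h k.+1) /\
      mean P (pot th ka h k.+1) <= mean P (fun w => f (X h k w, xi h k w)).
    by apply: integ_le => // w; rewrite lerDl mulr_ge0//; exact: (nm k).2.
  have [i2 _] : integ P (mom th ka h k) /\
      mean P (mom th ka h k) <= mean P (pot th ka h k).
    apply: integ_le => // w; rewrite /potential -addrA lerDl.
    have [_ _ _ z0] := admissible_brownian_walk B mu h c0 k w.
    rewrite addr_ge0// mulr_ge0//.
    - exact: upcoef_ge0.
    - by rewrite ltW// upvalue_gt0.
    - exact: downcoef_ge0.
    - by rewrite ltW// downvalue_gt0.
  split=> //.
  have -> : E h * mean P (pot th ka h k) + th * (e * mean P (len h k) + C * h ^+ 2) =
      mean P (fun w => g (X h k w, xi h k w)).
    rewrite -(meanZ (expR_ge0 _) ik) -(meanZ (ltW e0) il) -[C * _](mean_cst P) -meanD//; first last.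
    + by apply: integ_cst; exact: mulr_ge0.
    + by apply: integZ => //; exact: ltW.
    by rewrite -meanZ// -meanD//; exact: integZ.
  by rewrite -(meanZ Eh0 i2) -meanD//; exact: integZ.
have ik k : integ P (pot th ka h k).
  elim: k => [|k /step[]//].
  exact: (integ_cst P (potential_ge0 c0 p0 q0 th0 ka0 (lexx (s0.2)))).
by move=> n; have [_ i2 H] := step n (ik n); split.
Qed.

Let integ_z h n : 0 < h -> h <= 1 -> integ P (z h n).
Proof.
move=> h0 h1; have [C C0 CP] := pot_up ltr01.
have [_ + _] := CP 0 1 h (lexx 0) ler01 h0 h1 n.
rewrite (_ : (fun w => _) = z h n)//; apply/funext => w.
by rewrite /moment mul0r add0r mul1r.
Qed.

Let k0 th ka : R := upcoef c p q th ka 0 + downcoef c p q th ka 0.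

Let k0_ge0 th ka : 0 <= th -> 0 <= ka -> 0 <= k0 th ka.
Proof. by move=> ? ?; rewrite addr_ge0 ?upcoef_ge0 ?downcoef_ge0. Qed.

Let coefE th ka x : upcoef c p q th ka x + downcoef c p q th ka x
  = 4 * th * x + k0 th ka.
Proof. by rewrite /k0 /upcoef /downcoef; ring. Qed.

Let pot_lo e : 0 < e -> exists2 C : R, 0 <= C &
  forall th ka h, 0 <= th -> 0 <= ka -> 0 < h -> h <= 1 -> forall n,
  E h * mean P (pot th ka h n) <= mean P (pot th ka h n.+1)
    + ((E h - 1) * mean P (mom th ka h n)
    + (4 * th * e * mean P (fun w => z h n w * len h n w)
    + (4 * th * C * h ^+ 2 * mean P (z h n)
    + (k0 th ka * e * mean P (len h n) + k0 th ka * C * h ^+ 2)))).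
Proof.
move=> e0.
have [C C0 CP] := potential_step_ge c0 p0 q0 rootp rootq nu0 e0.
have [C' _ CP'] := pot_up e0.
have [M M0 MP] := barrier_bounded c0 p0 q0.
exists C => // th ka h th0 ka0 h0 h1 n.
have Eh0 := E1_ge0 h0.
have h20 : 0 <= h ^+ 2 by exact: sqr_ge0.
have kk := k0_ge0 th0 ka0.
pose g (sx : (R * R * R) * R) := potential c p q th ka (pushstep c sx.1 sx.2)
  + (E h - 1) * moment th ka sx.1.2
  + (upcoef c p q th ka sx.1.2 + downcoef c p q th ka sx.1.2)
     * (e * total_over c sx + C * h ^+ 2).
have mf : measurable_fun [set: (R * R * R) * R]
    (fun sx => E h * potential c p q th ka sx.1).
  apply: measurable_funM; first exact: measurable_cst.
  by apply: mfst; exact: measurable_potential.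
have mg : measurable_fun setT g.
  apply: measurable_funD; first apply: measurable_funD.
  - by apply: mstep; exact: measurable_potential.
  - by rewrite /moment; measurability.
  - apply: measurable_funM; first by rewrite /upcoef /downcoef; measurability.
    apply: measurable_funD; last exact: measurable_cst.
    by apply: measurable_funM; [exact: measurable_cst|exact: measurable_total_over].
have [il _] := bar_rec n h0.
have [_ izl _] := wbar_rec M0 MP h0 n.
have [ip im _] := CP' th ka h th0 ka0 h0 h1 n.
have [ip1 _ _] := CP' th ka h th0 ka0 h0 h1 n.+1.
have iz := integ_z n h0 h1.
have t1 : 0 <= 4 * th * e by rewrite !mulr_ge0// ltW.
have t2 : 0 <= 4 * th * C * h ^+ 2 by rewrite mulr_ge0// mulr_ge0// mulr_ge0.
have t3 : 0 <= k0 th ka * e by rewrite mulr_ge0// ltW.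
have t4 : 0 <= k0 th ka * C * h ^+ 2 by rewrite mulr_ge0// mulr_ge0.
have gE : (fun w => g (X h n w, xi h n w)) = (fun w =>
  pot th ka h n.+1 w + ((E h - 1) * mom th ka h n w
  + (4 * th * e * (z h n w * len h n w)
  + (4 * th * C * h ^+ 2 * z h n w
  + (k0 th ka * e * len h n w + k0 th ka * C * h ^+ 2))))).
  by apply/funext => w; rewrite /g coefE /=; ring.
have j5 := integ_cst P t4.
have j4 := integZ t3 il.
have j45 := integD j4 j5.
have j3 := integZ t2 iz.
have j345 := integD j3 j45.
have j2 := integZ t1 izl.
have j2345 := integD j2 j345.
have j1 := integZ Eh0 im.
have j12345 := integD j1 j2345.
have ig : integ P (fun w => g (X h n w, xi h n w)) by rewrite gE; exact: integD.
have [_] := transfer (n := n) h0 mf mg (fun s sa => CP th ka h s th0 ka0 h0 h1 sa) ig.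
rewrite gE (meanZ (expR_ge0 _) ip) (meanD ip1 j12345) (meanD j1 j2345) (meanD j2 j345).
by rewrite (meanD j3 j45) (meanD j4 j5) mean_cst (meanZ Eh0 im) (meanZ t1 izl) (meanZ t2 iz) (meanZ t3 il).
Qed.

Local Notation ds h g N := (discsum (r h) g N).

Let r_gt0 h : 0 < r h. Proof. exact: expR_gt0. Qed.

(* The bounds on the discounted overshoots are uniform in h. *)
Let ds_len h N : 0 < h -> ds h (fun n => mean P (len h n)) N <= barrier c p q s0.
Proof.
move=> h0; have H n : mean P (bar h n.+1) + mean P (len h n) <= E h * mean P (bar h n) + 0.
  by rewrite addr0; have [] := bar_rec n h0.
have := discsum_super (r_gt0 h) (rE h) H N.
have -> : discsum (r h) (fun=> 0) N = 0.
  by rewrite /discsum big1// => i _; rewrite mulr0.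
have -> : mean P (bar h 0%N) = barrier c p q s0 := mean_cst P (barrier c p q s0).
rewrite addr0; apply: le_trans.
by rewrite lerDr mulr_ge0 ?exprn_ge0 ?expR_ge0// mean_ge0//; have [] := integ_bar N h0.
Qed.

Let ds_zlen M h N : 0 <= M -> (forall s, admissible c s -> barrier c p q s <= M) ->
  0 < h ->
  ds h (fun n => mean P (fun w => z h n w * len h n w)) N <= M * barrier c p q s0.
Proof.
move=> M0 MP h0; pose wb k := mean P (fun w => (z h k w + M) * bar h k w).
have H n : wb n.+1 + mean P (fun w => z h n w * len h n w) <= E h * wb n + 0.
  by rewrite addr0; have [] := wbar_rec M0 MP h0 n.
have := discsum_super (r_gt0 h) (rE h) H N.
have -> : discsum (r h) (fun=> 0) N = 0.
  by rewrite /discsum big1// => i _; rewrite mulr0.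
have -> : wb 0%N = (0 + M) * barrier c p q s0 :=
  mean_cst P ((0 + M) * barrier c p q s0).
rewrite addr0 add0r; apply: le_trans.
rewrite lerDr mulr_ge0 ?exprn_ge0 ?expR_ge0// mean_ge0//.
by have [[]] := wbar_rec M0 MP h0 N.
Qed.

(* There are of the order of 1 / h steps before the exponential time. *)
Let ds_1 h N : 0 < h -> nu * h * ds h (fun=> 1) N <= 1.
Proof.
move=> h0; have H (n : nat) : 1 + (E h - 1) * 1 <= E h * 1 + 0 by lra.
have := discsum_super (e := fun=> 1) (g := fun=> (E h - 1) * 1) (k := fun=> 0)
  (r_gt0 h) (rE h) H N.
have -> : discsum (r h) (fun=> 0) N = 0.
  by rewrite /discsum big1// => i _; rewrite mulr0.
rewrite discsumZ addr0; apply: le_trans.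
apply: (@le_trans _ _ ((E h - 1) * discsum (r h) (fun=> 1) N)).
  by rewrite ler_wpM2r ?E1// discsum_ge0.
by rewrite lerDr mulr_ge0 ?exprn_ge0 ?expR_ge0.
Qed.

Let ds_up e : 0 < e -> exists2 C : R, 0 <= C &
  forall th ka h, 0 <= th -> 0 <= ka -> 0 < h -> h <= 1 -> forall N,
  (E h - 1) * ds h (fun n => mean P (mom th ka h n)) N <=
    potential c p q th ka s0 + th * (barrier c p q s0 * e + C / nu * h).
Proof.
move=> e0; have [C C0 CP] := pot_up e0.
exists C => // th ka h th0 ka0 h0 h1 N.
have H n : mean P (pot th ka h n.+1) + (E h - 1) * mean P (mom th ka h n) <=
    E h * mean P (pot th ka h n) + th * (e * mean P (len h n) + C * h ^+ 2 * 1).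
  by rewrite mulr1; have [] := CP th ka h th0 ka0 h0 h1 n.
have := discsum_super (r_gt0 h) (rE h) H N.
have -> : mean P (pot th ka h 0%N) = potential c p q th ka s0 :=
  mean_cst P (potential c p q th ka s0).
rewrite !discsumZ discsumD !discsumZ => K.
have pN : 0 <= r h ^+ N * mean P (pot th ka h N).
  by rewrite mulr_ge0 ?exprn_ge0 ?expR_ge0// mean_ge0//; exact: nnm_pot.
have L1 : e * ds h (fun n => mean P (len h n)) N <= barrier c p q s0 * e.
  by rewrite mulrC ler_wpM2r ?(ltW e0)// ds_len.
have L2 : C * h ^+ 2 * ds h (fun=> 1) N <= C / nu * h.
  have -> : C * h ^+ 2 * ds h (fun=> 1) N =
      C / nu * h * (nu * h * ds h (fun=> 1) N) by field; rewrite gt_eqF.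
  by rewrite ler_piMr ?ds_1// mulr_ge0 ?(ltW h0)// divr_ge0 ?(ltW nu0).
have := ler_wpM2l th0 (lerD L1 L2); lra.
Qed.

(* The potential grows at most like the square of the pushing, whose
   discounted sum converges. *)
Let tail th ka h eps : 0 <= th -> 0 <= ka -> 0 < h -> h <= 1 -> 0 < eps ->
  exists N, r h ^+ N * mean P (pot th ka h N) <= eps.
Proof.
move=> th0 ka0 h0 h1 eps0.
have [M M0 MP] := barrier_bounded c0 p0 q0.
have [C C0 CP] := pot_up ltr01; have [C' C0' CP'] := ds_up ltr01.
pose K := th + ka + 4 * th * M + k0 th ka * M.
have K0 : 0 <= K.
  apply: addr_ge0; last by rewrite mulr_ge0// k0_ge0.
  by apply: addr_ge0; [exact: addr_ge0|rewrite mulr_ge0// mulr_ge0].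
pose g n := 1 + mean P (mom 1 0 h n).
have im n : integ P (mom 1 0 h n) by have [] := CP 1 0 h ler01 (lexx 0) h0 h1 n.
have g0 n : 0 <= g n by rewrite addr_ge0// mean_ge0//; have [] := im n.
have pg n : mean P (pot th ka h n) <= K * g n.
  have i1 : integ P (fun w => 1 + mom 1 0 h n w) by apply: integD => //; exact: integ_cst.
  have [_] : integ P (pot th ka h n) /\
    mean P (pot th ka h n) <= mean P (fun w => K * (1 + mom 1 0 h n w)).
    apply: integ_le; [exact: nnm_pot|exact: integZ|].
    move=> w; have sa := admissible_brownian_walk B mu h c0 n w.
    case: (X h n w) sa => -[a b] x sa; have [/= _ _ _ x0] := sa.
    have A0 y : 0 <= upvalue c p q y by rewrite ltW// upvalue_gt0.
    have D0 y : 0 <= downvalue c p q y by rewrite ltW// downvalue_gt0.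
    have [AM DM] : upvalue c p q a <= M /\ downvalue c p q b <= M.
      have := MP _ sa; rewrite /barrier /=.
      by have := A0 a; have := A0 b; have := D0 a; have := D0 b; split; lra.
    rewrite /potential /=.
    have u0 := upcoef_ge0 c0 p0 q0 th0 ka0 x0.
    have v0 := downcoef_ge0 c0 p0 q0 th0 ka0 x0.
    have h2 : upcoef c p q th ka x * upvalue c p q a +
        downcoef c p q th ka x * downvalue c p q b <= (4 * th * x + k0 th ka) * M.
      rewrite -coefE [leRHS]mulrDl.
      by apply: lerD; apply: ler_wpM2l.
    have xx : x <= 1 + x ^+ 2 by nra.
    have x20 : 0 <= x ^+ 2 by exact: sqr_ge0.
    rewrite /moment /K mul1r mul0r addr0.
    have g1 := ler_wpM2l ka0 xx.
    have tM : 0 <= 4 * th * M by rewrite mulr_ge0// mulr_ge0.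
    have g2 := ler_wpM2l tM xx.
    have g3 : 0 <= k0 th ka * M * x ^+ 2 by rewrite mulr_ge0// mulr_ge0// k0_ge0.
    lra.
  by rewrite (meanZ K0 i1) (meanD (integ_cst P ler01) (im n)) mean_cst.
have E10 : 0 < E h - 1 by rewrite (lt_le_trans _ (E1 h0))// mulr_gt0.
have gM N : ds h g N <= 1 / (nu * h) +
    (potential c p q 1 0 s0 + 1 * (barrier c p q s0 * 1 + C' / nu * h)) / (E h - 1).
  rewrite discsumD lerD//.
    by rewrite ler_pdivlMr ?mulr_gt0// mulrC ds_1.
  by rewrite ler_pdivlMr// mulrC CP'.
have [] := discsum_tail (r_gt0 h) g0 gM (eps := eps / (K + 1)).
  by rewrite divr_gt0// ltr_wpDl.
move=> N HN; exists N.
apply: (@le_trans _ _ (K * (r h ^+ N * g N))).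
  by rewrite mulrCA ler_wpM2l ?exprn_ge0 ?expR_ge0.
apply: (@le_trans _ _ (K * (eps / (K + 1)))); first by rewrite ler_wpM2l.
rewrite mulrCA ler_piMr ?(ltW eps0)// ler_pdivrMr ?ltr_wpDl// mul1r lerDl.
by [].
Qed.

(** The discounted sums of the moments of the pushing converge, as the mesh
    decreases, to the initial value of the potential. *)
Lemma discounted_moments th ka : 0 <= th -> 0 <= ka ->
  exists2 k : R, 0 <= k & forall e, 0 < e -> exists2 C : R, 0 <= C &
  forall h, 0 < h -> h <= 1 ->
  [/\ forall n, integ P (mom th ka h n),
      forall N, (E h - 1) * ds h (fun n => mean P (mom th ka h n)) N
        <= potential c p q th ka (0, c, 0) + (k * e + C * h)
    & forall eps : R, 0 < eps -> exists N, potential c p q th ka (0, c, 0)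
        <= (E h - 1) * ds h (fun n => mean P (mom th ka h n)) N
           + (k * e + C * h + eps)].
Proof.
move=> th0 ka0; have [M M0 MP] := barrier_bounded c0 p0 q0.
pose sg := barrier c p q s0.
have sg0 : 0 <= sg by exact: barrier_ge0.
pose zt := potential c p q 0 1 s0.
have zt0 : 0 <= zt by exact: (potential_ge0 c0 p0 q0 (lexx 0) ler01 (lexx (s0.2))).
have kk := k0_ge0 th0 ka0.
exists (th * sg + 4 * th * (M * sg) + k0 th ka * sg).
  by rewrite !addr_ge0// ?mulr_ge0.
move=> e e0; have [C1 C10 UP] := ds_up e0; have [C2 C20 LO] := pot_lo e0.
have [C3 _ CP] := pot_up e0.
exists (th * C1 / nu + (4 * th * C2 * zt / nu + k0 th ka * C2 / nu)).
  by rewrite !addr_ge0// divr_ge0 ?(ltW nu0)// ?mulr_ge0.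
move=> h h0 h1.
have nuh : 0 < nu * h by rewrite mulr_gt0.
have q1 : 0 <= 4 * th * (M * sg) * e + k0 th ka * sg * e.
  by rewrite addr_ge0// mulr_ge0 ?(ltW e0)// ?mulr_ge0.
have q2 : 0 <= (4 * th * C2 * zt / nu + k0 th ka * C2 / nu) * h.
  by rewrite mulr_ge0 ?(ltW h0)// addr_ge0// divr_ge0 ?(ltW nu0)// ?mulr_ge0.
have q3 : 0 <= th * sg * e + th * C1 / nu * h.
  by rewrite addr_ge0// mulr_ge0 ?(ltW e0) ?(ltW h0)// ?divr_ge0 ?(ltW nu0)// mulr_ge0.
split=> [n|N|eps eps0]; first by have [] := CP th ka h th0 ka0 h0 h1 n.
  have := UP th ka h th0 ka0 h0 h1 N; rewrite -/sg -/s0; lra.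
have [N HN] := tail th0 ka0 h0 h1 eps0; exists N.
have H n : E h * mean P (pot th ka h n) <= mean P (pot th ka h n.+1)
    + ((E h - 1) * mean P (mom th ka h n)
    + (4 * th * e * mean P (fun w => z h n w * len h n w)
    + (4 * th * C2 * h ^+ 2 * mean P (z h n)
    + (k0 th ka * e * mean P (len h n) + k0 th ka * C2 * h ^+ 2 * 1)))).
  by rewrite mulr1; exact: LO.
have := discsum_sub (r_gt0 h) (rE h) H N.
have -> : mean P (pot th ka h 0%N) = potential c p q th ka s0 :=
  mean_cst P (potential c p q th ka s0).
rewrite !discsumD !discsumZ -/s0.
have b1 : 4 * th * e * ds h (fun n => mean P (fun w => z h n w * len h n w)) N
    <= 4 * th * e * (M * sg).
  by rewrite ler_wpM2l ?ds_zlen// mulr_ge0 ?(ltW e0)// mulr_ge0.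
have b2 : 4 * th * C2 * h ^+ 2 * ds h (fun n => mean P (z h n)) N
    <= 4 * th * C2 * zt / nu * h.
  have zb : nu * h * ds h (fun n => mean P (z h n)) N <= zt.
    have := UP 0 1 h (lexx 0) ler01 h0 h1 N; rewrite mul0r addr0 -/zt.
    have -> : (fun n => mean P (mom 0 1 h n)) = (fun n => mean P (z h n)).
      apply/funext => n; congr (mean P _); apply/funext => w.
      by rewrite /moment mul0r add0r mul1r.
    apply: le_trans; rewrite ler_wpM2r ?E1//.
    by apply: discsum_ge0 => // n; apply: mean_ge0; exact: nnm_z.
  have -> : 4 * th * C2 * h ^+ 2 * ds h (fun n => mean P (z h n)) N =
      4 * th * C2 / nu * h * (nu * h * ds h (fun n => mean P (z h n)) N).
    by field; rewrite gt_eqF.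
  have -> : 4 * th * C2 * zt / nu * h = 4 * th * C2 / nu * h * zt by ring.
  rewrite ler_wpM2l// mulr_ge0 ?(ltW h0)// divr_ge0 ?(ltW nu0)// mulr_ge0//.
  by rewrite mulr_ge0.
have b3 : k0 th ka * e * ds h (fun n => mean P (len h n)) N <= k0 th ka * e * sg.
  by rewrite ler_wpM2l ?ds_len// mulr_ge0 ?(ltW e0).
have b4 : k0 th ka * C2 * h ^+ 2 * ds h (fun=> 1) N <= k0 th ka * C2 / nu * h.
  have -> : k0 th ka * C2 * h ^+ 2 * ds h (fun=> 1) N =
      k0 th ka * C2 / nu * h * (nu * h * ds h (fun=> 1) N).
    by field; rewrite gt_eqF.
  by rewrite ler_piMr ?ds_1// mulr_ge0 ?(ltW h0)// divr_ge0 ?(ltW nu0)// mulr_ge0.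
lra.
Qed.

End discounted_moments.

(** * Stopping at an independent exponential time *)

Section exponential_time.
Context d (T : measurableType d) (R : realType) (P : probability T R).
Variables (B : R -> {RV P >-> R}) (S : {RV P >-> R}) (mu c nu h : R).
Hypotheses (BM : standard_brownian_motion B) (c0 : 0 < c) (nu0 : 0 < nu).
Hypotheses (h0 : 0 < h).
Hypothesis S_law : forall A : set R, measurable A ->
  distribution P S A = exponential_prob nu A.
Hypothesis S_indep : process_independent P (bm_with_drift B mu) S.
Implicit Types n N : nat.

Local Notation W := (bm_with_drift B mu).
Local Notation X := (brownian_walk B mu c h).

Let slot n : set R := [set` `[n%:R * h, n.+1%:R * h[].

Let mslot n : measurable (slot n). Proof. exact: measurable_itv. Qed.

Let Sslot n : set T := S @^-1` slot n.

Let mSslot n : measurable (Sslot n).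
Proof.
rewrite /Sslot -[X in measurable X]setTI.
exact: measurable_funP.
Qed.

Lemma exponential_lt0 : P (S @^-1` [set` `]-oo, (0:R)[]) = 0%E.
Proof.
rewrite -[LHS]/(distribution P S _) S_law; last exact: measurable_itv.
rewrite /exponential_prob integral0_eq// => x; rewrite /= in_itv /= => x0.
by rewrite lt0_exponential_pdf.
Qed.

Let exponential_itvo (x : R) : 0 <= x ->
  exponential_prob nu [set` `[(0:R), x[] = (1 - expR (- (nu * x)))%:E.
Proof.
rewrite le_eqVlt => /predU1P[<-|x0].
  by rewrite set_itvco0 /exponential_prob integral_set0 mulr0 oppr0 expR0 subrr.
rewrite /exponential_prob integral_itv_bndo_bndc; last first.
  apply/measurable_EFinP; apply: measurable_funTS.
  exact: measurable_exponential_pdf.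
rewrite -[LHS]/(exponential_prob nu _) exponential_prob_itv0c//.
by rewrite mulNr EFinB.
Qed.

(* The number of completed steps is geometric. *)
Let prob_slot n : P (Sslot n) = (expR (- (nu * h)) ^+ n * (1 - expR (- (nu * h))))%:E.
Proof.
pose I n : set R := [set` `[(0:R), n%:R * h[].
have mI k : measurable (S @^-1` I k).
  by rewrite -[X in measurable X]setTI; apply: measurable_funP => //; exact: measurable_itv.
have E k : P (S @^-1` I k) = (1 - expR (- (nu * h)) ^+ k)%:E.
  rewrite -[LHS]/(distribution P S (I k)) S_law; last exact: measurable_itv.
  rewrite exponential_itvo ?mulr_ge0 ?(ltW h0)// -expRM_natl.
  by congr (1 - expR _)%:E; ring.
have nh : 0 <= n%:R * h by rewrite mulr_ge0 ?(ltW h0).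
have nSh : n%:R * h <= n.+1%:R * h by rewrite ler_pM2r// ler_nat.
have U : S @^-1` I n.+1 = S @^-1` I n `|` Sslot n.
  apply/seteqP; split => w; rewrite /Sslot /slot /I /= !in_itv /=.
    move=> /andP[s0 sn]; have [sl|sl] := ltP (S w) (n%:R * h).
      by left; rewrite s0.
    by right.
  by case=> /andP[s1 s2]; apply/andP; split => //;
    [exact: lt_le_trans s2 nSh|exact: le_trans nh s1].
have M : P (S @^-1` I n `|` Sslot n) = (P (S @^-1` I n) + P (Sslot n))%E.
  apply: measureU => //; apply/seteqP; split => // w.
  rewrite /Sslot /slot /I /= !in_itv /=.
  by move=> [/andP[_ s1] /andP[s2 _]]; move: s1; rewrite ltNge s2.
have := E n.+1; rewrite U M E.
have fS : P (Sslot n) \is a fin_num by exact: fin_num_measure.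
rewrite -(fineK fS) -EFinD => -[e]; congr (_%:E).
rewrite mulrBr mulr1 -exprSr; lra.
Qed.

(** The walk is a function of the path, hence independent of the time. *)
Let walk_time_indep n (A : set (R * R * R)) (A' : set R) :
  measurable A -> measurable A' ->
  P (X n @^-1` A `&` S @^-1` A') = (P (X n @^-1` A) * distribution P S A')%E.
Proof.
move=> mA mA'; apply: S_indep; last by exists A' => //; rewrite setTI.
have mWg (t : R) : 0 <= t -> measurable_fun (setT : set (g_sigma_algebraType
    (\bigcup_(t in [set t : R | 0 <= t])
       preimage_set_system setT (W t) measurable))) (W t).
  move=> t0; apply: measurable_generated => A1 mA1.
  by exists t => //; exists A1 => //; rewrite setTI.
have := @measurable_walk _ (g_sigma_algebraType (\bigcup_(t in [set t : R | 0 <= t])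
       preimage_set_system setT (W t) measurable)) R c
   (fun i w => brownian_incr B mu h i w) n.
move=> /(_ _ measurableT _ mA); rewrite setTI; apply.
move=> i _; apply: measurable_funB; apply: mWg; exact: mulr_ge0 (ltW h0).
Qed.

Variables th ka : R.
Hypotheses (th0 : 0 <= th) (ka0 : 0 <= ka).
Local Notation mom n := (fun w => moment th ka (X n w).2).
Hypothesis int_mom : forall n, integ P (mom n).

(** The pushing during the grid steps that are completed at the exponential
    time. *)
Definition stopped_push (w : T) : R :=
  gridpush c h (W ^~ w) (Num.truncn (S w / h)).

Let term n w : \bar R := (mom n w * \1_(slot n) (S w))%:E.

Let term_ge0 n w : (0 <= term n w)%E.
Proof. by rewrite lee_fin mulr_ge0 ?ler0n//; have [[_ +] _] := int_mom n; apply. Qed.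

Let mterm n : measurable_fun setT (term n).
Proof.
apply/measurable_EFinP; apply: measurable_funM; first by have [[]] := int_mom n.
apply: (measurableT_comp (measurable_indic (mslot n))).
exact: measurable_funP.
Qed.

Let int_term n : (\int[P]_w term n w)%E =
  (expR (- (nu * h)) ^+ n * (1 - expR (- (nu * h))) * mean P (mom n))%:E.
Proof.
pose f (sy : (R * R * R) * R) : \bar R :=
  (Num.max 0 (moment th ka sy.1.2) * \1_(slot n) sy.2)%:E.
have mm : measurable_fun [set: (R * R * R) * R]
    (fun sy => Num.max 0 (moment th ka sy.1.2)).
  by apply: measurable_maxr; [exact: measurable_cst|rewrite /moment; measurability].
have mf : measurable_fun setT f.
  apply/measurable_EFinP; apply: measurable_funM => //.
  by apply: (measurableT_comp (measurable_indic (mslot n))); exact: measurable_snd.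
have m_ge0 w : 0 <= mom n w by have [[_ +] _] := int_mom n; apply.
have f0 sy : (0 <= f sy)%E by rewrite lee_fin mulr_ge0 ?ler0n// le_max lexx.
transitivity (\int[P]_w f (X n w, S w))%E.
  by apply: eq_integral => w _; rewrite /f /= max_r.
have mX : measurable_fun setT (X n) by exact: measurable_brownian_walk.
have mS : measurable_fun setT S by exact: measurable_funP.
rewrite (@ge0_integral_indep _ _ _ P _ _ _ _ (distribution P S) (X n) S f mX mS
  (@walk_time_indep n) mf f0).
transitivity (\int[P]_w ((expR (- (nu * h)) ^+ n * (1 - expR (- (nu * h))))%:E
    * (mom n w)%:E))%E.
  apply: eq_integral => w _; rewrite /f /= max_r//.
  under eq_integral do rewrite EFinM.
  rewrite ge0_integralZl//; last 2 first.
  - exact/measurable_EFinP/measurable_indic.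
  - by rewrite lee_fin; exact: m_ge0.
  rewrite integral_indic// setIT muleC; congr (_ * _)%E.
  exact: prob_slot.
rewrite ge0_integralZl//.
- by rewrite -[X in (_ * X)%E]/(rint P (mom n)) meanE// -EFinM.
- by apply/measurable_EFinP; have [[]] := int_mom n.
- by move=> w _; rewrite lee_fin; exact: m_ge0.
- rewrite lee_fin mulr_ge0 ?exprn_ge0 ?expR_ge0// subr_ge0 expR_le1.
  by rewrite oppr_le0 mulr_ge0 ?ltW.
Qed.

(* For S w < 0 both sides vanish, since no step is completed. *)
Let stopped_pushE w :
  (moment th ka (stopped_push w))%:E = (\sum_(n <oo) term n w)%E.
Proof.
have slotE n : (S w \in slot n) = (n%:R * h <= S w < n.+1%:R * h).
  by apply/idP/idP; rewrite inE /slot /= in_itv.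
pose k := Num.truncn (S w / h).
have mom0 : moment th ka 0 = 0 by rewrite /moment expr0n !mulr0 addr0.
have other n : n != k -> term n w = 0%E.
  move=> nk; rewrite /term indicE slotE.
  case: andP => [[s1 s2]|_]; last by rewrite mulr0.
  case/eqP: nk; apply/esym; apply: Num.Theory.truncn_def.
  by rewrite ler_pdivlMr// ltr_pdivrMr// s1 s2.
rewrite (@nneseriesD1 _ (term ^~ w) k xpredT)//.
rewrite eseries0; last by move=> i _ /= ik; exact: other.
rewrite adde0.
rewrite /term /stopped_push -/k indicE slotE.
have [s0|s0] := leP 0 (S w).
  have : 0 <= S w / h by rewrite divr_ge0// ltW.
  move=> /Num.Theory.truncn_itv; rewrite -/k ler_pdivlMr// ltr_pdivrMr// => ->.
  by rewrite mulr1.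
have -> : k = 0%N.
  apply/eqP; rewrite -leqn0 Num.Theory.truncn_le_nat ltr_pdivrMr// mul1r.
  exact: lt_trans h0.
by rewrite /gridpush /= mom0 mul0r.
Qed.

Lemma measurable_stopped_moment :
  measurable_fun setT (fun w => moment th ka (stopped_push w)).
Proof.
apply/measurable_EFinP.
under [X in measurable_fun _ X]eq_fun do rewrite stopped_pushE.
by apply: ge0_emeasurable_sum => // n w _; exact: term_ge0.
Qed.

Lemma rint_stopped_moment : rint P (fun w => moment th ka (stopped_push w)) =
  (\sum_(n <oo) (expR (- (nu * h)) ^+ n * (1 - expR (- (nu * h))) * mean P (mom n))%:E)%E.
Proof.
rewrite /rint; under eq_integral do rewrite stopped_pushE.
rewrite integral_nneseries//.
by apply: eq_eseriesr => n _; exact: int_term.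
Qed.

End exponential_time.

(** * Passage to the limit *)

Section null_sets.
Context d (T : measurableType d) (R : realType).
Variable m : {measure set T -> \bar R}.
Local Open Scope ereal_scope.

Import HBNNSimple.

Let le_ge0_integral (f g : T -> \bar R) : (forall x, 0 <= f x) ->
  (forall x, f x <= g x) -> \int[m]_x f x <= \int[m]_x g x.
Proof.
move=> f0 fg; rewrite !ge0_integralTE//; last first.
  by move=> x; exact: le_trans (fg x).
apply: ereal_sup_le => _ [k /= kf <-].
by exists k => //= x; exact: le_trans (fg x).
Qed.

(** The integral being a supremum over simple functions, it ignores the values
    on a null set, even if these make the integrand nonmeasurable. *)
Lemma integral_eq_off_null (f g : T -> \bar R) (N : set T) :
  measurable N -> m N = 0 -> measurable_fun setT g -> (forall x, 0 <= g x) ->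
  (forall x, ~ N x -> f x = g x) -> \int[m]_x f x = \int[m]_x g x.
Proof.
move=> mN N0 mg g0 fg.
have mNb : measurable_fun [set: T] (fun x => x \in N).
  by apply: (measurable_fun_bool true) => //; rewrite setTI preimage_mem_true.
pose top (k : T -> \bar R) x := if x \in N then +oo else k x.
pose bot (k : T -> \bar R) x := if x \in N then 0 else k x.
have mtop k : measurable_fun setT k -> measurable_fun setT (top k).
  by move=> mk; apply: measurable_fun_ifT.
have mbot k : measurable_fun setT k -> measurable_fun setT (bot k).
  by move=> mk; apply: measurable_fun_ifT.
have top0 k : (forall x, 0 <= k x) -> forall x, 0 <= top k x.
  by move=> k0 x; rewrite /top; case: ifP => // _; exact: leey.
have bot0 k : (forall x, 0 <= k x) -> forall x, 0 <= bot k x.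
  by move=> k0 x; rewrite /bot; case: ifP.
have Itop k : measurable_fun setT k -> (forall x, 0 <= k x) ->
    \int[m]_x top k x = \int[m]_x k x.
  move=> mk k0; apply: ge0_ae_eq_integral => //; [exact: mtop|by move=> x _; exact: top0|].
  exists N; split=> // x /= Hx; apply: contrapT => xN; apply: Hx => _.
  by rewrite /top ifF//; apply/negbTE/negP; rewrite inE.
have Ibot k : measurable_fun setT k -> (forall x, 0 <= k x) ->
    \int[m]_x bot k x = \int[m]_x k x.
  move=> mk k0; apply: ge0_ae_eq_integral => //; [exact: mbot|by move=> x _; exact: bot0|].
  exists N; split=> // x /= Hx; apply: contrapT => xN; apply: Hx => _.
  by rewrite /bot ifF//; apply/negbTE/negP; rewrite inE.
(* The negative part vanishes off N; top and bot sandwich the positive part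
   between measurable functions. *)
rewrite integralE [X in _ - X](_ : _ = 0); last first.
  apply/eqP; rewrite eq_le integral_ge0 ?andbT; last by move=> x _; exact: funeneg_ge0.
  rewrite -(@integral0 _ T R m setT) -(Itop (cst 0))//.
  apply: le_ge0_integral => x; first exact: funeneg_ge0.
  rewrite /top; case: ifPn => [_|/negP]; first exact: leey.
  rewrite inE => /fg e; rewrite funenegE e /cst /= ge_max lexx andbT.
  by rewrite oppe_le0.
rewrite oppe0 adde0; apply/eqP; rewrite eq_le; apply/andP; split.
  rewrite -(Itop g)//; apply: le_ge0_integral => x; first exact: funepos_ge0.
  rewrite /top; case: ifPn => [_|/negP]; first exact: leey.
  by rewrite inE => /fg e; rewrite funeposE e ge_max lexx g0.
rewrite -(Ibot g)//; apply: le_ge0_integral => x; first exact: bot0.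
rewrite /bot; case: ifPn => [_|/negP]; first exact: funepos_ge0.
by rewrite inE => /fg e; rewrite funeposE e le_max lexx.
Qed.

End null_sets.

Section limit.
Context d (T : measurableType d) (R : realType) (P : probability T R).
Variables (B : R -> {RV P >-> R}) (S : {RV P >-> R}) (mu c nu p q : R).
Hypotheses (BM : standard_brownian_motion B) (c0 : 0 < c) (nu0 : 0 < nu).
Hypotheses (p0 : 0 < p) (q0 : 0 < q).
Hypotheses (rootp : p * mu + p ^+ 2 / 2 = nu)
  (rootq : - q * mu + q ^+ 2 / 2 = nu).
Hypothesis S_law : forall A : set R, measurable A ->
  distribution P S A = exponential_prob nu A.
Hypothesis S_indep : process_independent P (bm_with_drift B mu) S.
Variables th ka : R.
Hypotheses (th0 : 0 <= th) (ka0 : 0 <= ka).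

Let g k w := moment th ka (stopped_push B S mu c (mesh k) w).

Let V0 : R := potential c p q th ka (0, c, 0).

Let g_ge0 k w : 0 <= g k w.
Proof. by apply: moment_ge0 => //; exact: gridpush_ge0. Qed.

Let integ_mom k n : integ P (fun w => moment th ka (brownian_walk B mu c (mesh k) n w).2).
Proof.
have [K _ H] := discounted_moments BM c0 nu0 p0 q0 rootp rootq th0 ka0.
have [C _ HC] := H 1 ltr01.
by have [H1 _ _] := HC _ (mesh_gt0 k) (mesh_le1 k).
Qed.

Let mg k : measurable_fun setT (g k).
Proof.
exact: (measurable_stopped_moment S (mesh_gt0 k) (integ_mom k)).
Qed.

Let rint_g_cvg : rint P (g k) @[k --> \oo] --> V0%:E.
Proof.
have [K K0 H] := discounted_moments BM c0 nu0 p0 q0 rootp rootq th0 ka0.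
have bound eps : 0 < eps -> \forall k \near \oo,
    ((V0 - eps)%:E <= rint P (g k))%E /\ (rint P (g k) <= (V0 + eps)%:E)%E.
  move=> eps0; pose e := eps / 4 / (K + 1).
  have K1 : 0 < K + 1 by rewrite ltr_wpDl.
  have e0 : 0 < e by rewrite divr_gt0// divr_gt0.
  have Ke : K * e <= eps / 4.
    by rewrite /e mulrCA ger_pMr ?divr_gt0// ler_pdivrMr// mul1r lerDl.
  have [C C0 HC] := H e e0.
  have C1 : 0 < C + 1 by rewrite ltr_wpDl.
  have e4 : 0 < eps / 4 / (C + 1) by rewrite divr_gt0// divr_gt0.
  have := @mesh_cvg0 R; move/cvgrPdist_lt => /(_ _ e4); apply: filterS => k.
  rewrite sub0r normrN gtr0_norm ?mesh_gt0// => mk.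
  have Ck : C * mesh k <= eps / 4.
    apply: (@le_trans _ _ (C * (eps / 4 / (C + 1)))).
      by rewrite ler_wpM2l// ltW.
    by rewrite mulrCA ger_pMr ?divr_gt0// ler_pdivrMr// mul1r lerDl.
  have [_ up lo] := HC _ (mesh_gt0 k) (mesh_le1 k).
  pose a n := expR (- (nu * mesh k)) ^+ n * (1 - expR (- (nu * mesh k))) *
    mean P (fun w => moment th ka (brownian_walk B mu c (mesh k) n w).2).
  have a0 n : 0 <= a n.
    rewrite mulr_ge0 ?mulr_ge0 ?exprn_ge0 ?expR_ge0//.
      by rewrite subr_ge0 expR_le1 oppr_le0 mulr_ge0 ?ltW ?mesh_gt0.
    by apply: mean_ge0; have [] := integ_mom k n.
  have sumE N : (\sum_(0 <= n < N) (a n)%:E)%E = ((expR (nu * mesh k) - 1) *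
      discsum (expR (- (nu * mesh k))) (fun n =>
        mean P (fun w => moment th ka (brownian_walk B mu c (mesh k) n w).2)) N)%:E.
    rewrite sumEFin big_mkord /discsum mulr_sumr; congr (_%:E).
    have e1 : (expR (nu * mesh k) - 1) * expR (- (nu * mesh k)) =
        1 - expR (- (nu * mesh k)) by rewrite mulrBl mul1r expRxMexpNx_1.
    by apply: eq_bigr => n _; rewrite /a exprSr -e1; ring.
  have -> : rint P (g k) = (\sum_(n <oo) (a n)%:E)%E.
    exact: (rint_stopped_moment nu0 (mesh_gt0 k) S_law S_indep (integ_mom k)).
  split.
    have e4' : 0 < eps / 4 by rewrite divr_gt0.
    have [N HN] := lo _ e4'; rewrite -/V0 in HN.
    apply: (@le_trans _ _ (\sum_(0 <= n < N) (a n)%:E)%E).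
      by rewrite sumE lee_fin; lra.
    by apply: nneseries_lim_ge => n _ _; rewrite lee_fin.
  apply: lime_le; first by apply: is_cvg_nneseries => n _ _; rewrite lee_fin.
  apply: nearW => N; rewrite sumE lee_fin.
  by have := up N; rewrite -/V0; lra.
apply/fine_cvgP; split.
  have := bound 1 ltr01; apply: filterS => k [h1 h2].
  rewrite ge0_fin_numE; first exact: le_lt_trans h2 (ltry _).
  exact: rint_ge0.
apply/cvgrPdist_le => eps eps0; have := bound eps eps0; apply: filterS => k [h1 h2].
have fk : rint P (g k) \is a fin_num.
  rewrite ge0_fin_numE; first exact: le_lt_trans h2 (ltry _).
  exact: rint_ge0.
move: h1 h2; rewrite -(fineK fk) !lee_fin => h1 h2.
by rewrite /= ler_norml; apply/andP; split; lra.
Qed.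

(** Along almost every path the discrete quantities converge to the continuous
    one from below, so that Fatou's lemma gives the upper bound and
    monotonicity the lower one. *)
Lemma integral_stopped_limit (F : T -> \bar R) :
  {ae P, forall w, (g k w)%:E @[k --> \oo] --> F w /\
     forall k, ((g k w)%:E <= F w)%E} ->
  (\int[P]_w F w = (potential c p q th ka (0, c, 0))%:E)%E.
Proof.
move=> [N [mN N0 NF]].
have offN w : ~ N w -> (g k w)%:E @[k --> \oo] --> F w /\
    forall k, ((g k w)%:E <= F w)%E.
  by move=> Nw; apply: contrapT => H; apply: Nw; exact: NF.
pose G w := limn_einf (fun k => (g k w)%:E).
have mgE k : measurable_fun setT (fun w => (g k w)%:E).
  by apply/measurable_EFinP; exact: mg.
have gE0 k w : (0 <= (g k w)%:E)%E by rewrite lee_fin g_ge0.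
have FG w : ~ N w -> F w = G w.
  by move=> /offN[cF _]; rewrite /G (cvg_limn_einf_sup cF).1.
have mG : measurable_fun setT G.
  rewrite /G /limn_einf; apply: measurableT_comp => //.
  apply: measurable_fun_limn_esup => k.
  by apply: measurableT_comp => //; exact: mgE.
have G0 w : (0 <= G w)%E.
  rewrite /G limn_einf_lim; apply: lime_ge; first exact: is_cvg_einfs.
  apply: nearW => k; apply: le_ereal_inf_tmp => _ [j _ <-]; exact: gE0.
rewrite (integral_eq_off_null mN N0 mG G0 FG).
apply/eqP; rewrite eq_le; apply/andP; split.
  apply: (le_trans (fatou P measurableT mgE (fun k w _ => gE0 k w))).
  by rewrite (cvg_limn_einf_sup rint_g_cvg).1.
apply: (cvge_le _ rint_g_cvg); apply: nearW => k.
apply: ae_ge0_le_integral => //.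
exists N; split=> // w /= Hw; apply: contrapT => Nw; apply: Hw => _.
by rewrite -FG//; have [_] := offN _ Nw; exact.
Qed.

End limit.

(** * Closed forms of the two moments *)

Section roots.
Context {R : realType}.
Variables mu nu : R.
Hypothesis nu0 : 0 < nu.

(** The numbers [- mu + root_radius] and [- mu - root_radius] are the roots of
    r ^ 2 / 2 + mu r = nu. *)
Definition root_radius : R := Num.sqrt (mu ^+ 2 + 2 * nu).
Local Notation del := root_radius.

Lemma root_radius_sqr : del ^+ 2 = mu ^+ 2 + 2 * nu.
Proof. by rewrite sqr_sqrtr// addr_ge0 ?sqr_ge0// mulr_ge0// ltW. Qed.

Lemma norm_lt_root_radius : `|mu| < del.
Proof.
rewrite -(sqrtr_sqr mu) ltr_sqrt; first by rewrite ltrDl mulr_gt0.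
by rewrite ltr_wpDl ?sqr_ge0// mulr_gt0.
Qed.

Lemma root_radiusB_gt0 : 0 < del - mu.
Proof. by rewrite subr_gt0 (le_lt_trans (ler_norm _) norm_lt_root_radius). Qed.

Lemma root_radiusD_gt0 : 0 < del + mu.
Proof.
by rewrite -[mu]opprK subr_gt0 (le_lt_trans _ norm_lt_root_radius)// -normrN ler_norm.
Qed.

Lemma root_radiusB_eq : (del - mu) * mu + (del - mu) ^+ 2 / 2 = nu.
Proof.
have -> : (del - mu) * mu + (del - mu) ^+ 2 / 2 = (del ^+ 2 - mu ^+ 2) / 2 by field.
by rewrite root_radius_sqr; field.
Qed.

Lemma root_radiusD_eq : - (del + mu) * mu + (del + mu) ^+ 2 / 2 = nu.
Proof.
have -> : - (del + mu) * mu + (del + mu) ^+ 2 / 2 = (del ^+ 2 - mu ^+ 2) / 2 by field.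
by rewrite root_radius_sqr; field.
Qed.

End roots.

Section closed_forms.
Context {R : realType}.
Variables mu c nu : R.
Hypotheses (c0 : 0 < c) (nu0 : 0 < nu).
Local Notation del := (root_radius mu nu).
Local Notation p := (del - mu).
Local Notation q := (del + mu).
Local Notation A := (upvalue c p q).
Local Notation D := (downvalue c p q).

Let x : R := expR (del * c).
Let y : R := expR (mu * c).

Let x_gt1 : 1 < x.
Proof.
by rewrite expR_gt1 mulr_gt0// (le_lt_trans (normr_ge0 _) (norm_lt_root_radius mu nu0)).
Qed.

Let y_gt0 : 0 < y. Proof. exact: expR_gt0. Qed.

Let px : expR (p * c) = x / y.
Proof. by rewrite mulrBl expRB. Qed.

Let mqx : expR (- (q * c)) = (x * y)^-1.
Proof. by rewrite expRN mulrDl expRD. Qed.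

Let qx : expR (q * c) = x * y.
Proof. by rewrite mulrDl expRD. Qed.

Let mpx : expR (- (p * c)) = (x / y)^-1.
Proof. by rewrite expRN px. Qed.

Let side : [/\ p != 0, q != 0, x != 0, y != 0 & x * x - 1 != 0].
Proof.
have x1 := x_gt1.
split; rewrite gt_eqF//.
- exact: root_radiusB_gt0.
- exact: root_radiusD_gt0.
- exact: lt_trans x1.
- by rewrite subr_gt0 mulr_egt1.
Qed.

Let V_eq : V c mu nu = del * 2 / (x - x^-1).
Proof.
rewrite /V -/del /sinh [c * _]mulrC expRN -/x.
by have [_ _ hx _ hx2] := side; field; rewrite hx hx2.
Qed.

Let hxy : x * y * x - y != 0.
Proof.
have [_ _ _ hy hx2] := side.
have -> : x * y * x - y = y * (x * x - 1) by ring.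
exact: mulf_neq0.
Qed.

Let nuE : 2 * nu = p * q.
Proof.
have -> : p * q = del ^+ 2 - mu ^+ 2 by ring.
by rewrite root_radius_sqr//; ring.
Qed.

Let theta_eq : theta c mu nu = del * ((x + x^-1) / (x - x^-1)) - mu.
Proof.
rewrite /theta -/del /coth /sinh /cosh [c * _]mulrC expRN -/x.
by have [_ _ hx _ hx2] := side; field; rewrite hx hx2.
Qed.

Let cosh_eq : cosh (mu * c) = (y + y^-1) / 2.
Proof. by rewrite /cosh expRN. Qed.

Lemma upvalue0E : A 0 = V c mu nu * y / (2 * nu).
Proof.
have [hp hq hx hy hx2] := side.
rewrite V_eq /upvalue !mulr0 oppr0 expR0 px mqx nuE.
by field; rewrite hp hq hx hx2 hy.
Qed.

Lemma upvaluecE : A c = (theta c mu nu + 2 * mu) / (2 * nu).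
Proof.
have [hp hq hx hy hx2] := side.
rewrite theta_eq /upvalue px mqx nuE.
by field; rewrite hp hq hx hx2 hy.
Qed.

Lemma downvalue0E : D 0 = theta c mu nu / (2 * nu).
Proof.
have [hp hq hx hy hx2] := side.
rewrite theta_eq /downvalue /upvalue subr0 mpx qx nuE.
by field; rewrite hp hq hx hx2 hy hxy.
Qed.

Lemma downvaluecE : D c = V c mu nu * y^-1 / (2 * nu).
Proof.
have [hp hq hx hy hx2] := side.
rewrite V_eq /downvalue /upvalue subrr !mulr0 oppr0 expR0 mpx qx nuE.
by field; rewrite hp hq hx hx2 hy hxy.
Qed.

Lemma potential_first :
  potential c p q 0 1 (0, c, 0) = V c mu nu / nu * cosh (c * mu).
Proof.
rewrite /potential /moment /upcoef /downcoef /= upvalue0E downvaluecE.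
rewrite [c * mu]mulrC cosh_eq; have [_ _ _ hy _] := side.
by field; rewrite hy gt_eqF.
Qed.

Lemma potential_second : potential c p q 1 0 (0, c, 0) = V c mu nu / nu ^+ 2
  * (V c mu nu + cosh (mu * c) * theta c mu nu + expR (mu * c) * mu).
Proof.
rewrite /potential /moment /upcoef /downcoef /= upvalue0E downvaluecE.
rewrite upvaluecE downvalue0E cosh_eq -/y; have [_ _ _ hy _] := side.
by field; rewrite hy gt_eqF.
Qed.

End closed_forms.

Section drift_paths.
Context d (T : measurableType d) (R : realType) (P : probability T R).

Lemma drift_continuous (B : R -> {RV P >-> R}) (mu : R) (w : T) :
  {within `[0, +oo[, continuous (fun t => B t w)} ->
  {within `[0, +oo[, continuous (bm_with_drift B mu ^~ w)}.
Proof.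
move=> /subspace_continuousP cB; apply/subspace_continuousP => t t0.
apply: cvgD; first exact: cB.
apply: cvg_within_filter; apply: cvgM; [exact: cvg_cst|exact: cvg_id].
Qed.

Lemma ae_nonneg_exponential (S : {RV P >-> R}) (nu : R) : 
  (forall A : set R, measurable A -> distribution P S A = exponential_prob nu A) ->
  {ae P, forall w, 0 <= S w}.
Proof.
move=> SL; exists (S @^-1` [set` `]-oo, (0:R)[]); split.
- by rewrite -[X in measurable X]setTI; exact: measurable_funP.
- exact: (exponential_lt0 SL).
- by move=> w /= /negP; rewrite -ltNge in_itv.
Qed.

End drift_paths.

Theorem mainTheorem9 (R : realType) (d : measure_display)
    (Omega : measurableType d) (P : probability Omega R)
    (B : R -> {RV P >-> R}) (S : {RV P >-> R}) (mu c nu : R) :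
  standard_brownian_motion B ->
  0 < c ->
  0 < nu ->
  (forall A : set R, measurable A ->
     distribution P S A = exponential_prob nu A) ->
  process_independent P (bm_with_drift B mu) S ->
  (\int[P]_w TVc c (fun t => bm_with_drift B mu t w) (S w)
   = (V c mu nu / nu * cosh (c * mu))%:E)%E
  /\
  (\int[P]_w (TVc c (fun t => bm_with_drift B mu t w) (S w) ^+ 2)
   = (V c mu nu / nu ^+ 2
      * (V c mu nu + cosh (mu * c) * theta c mu nu + expR (mu * c) * mu))%:E)%E.
Proof.
move=> BM c0 nu0 SL SI.
have p0 := root_radiusB_gt0 mu nu0; have q0 := root_radiusD_gt0 mu nu0.
have rp := root_radiusB_eq mu nu0; have rq := root_radiusD_eq mu nu0.
pose u w k := stopped_push B S mu c (mesh k) w.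
pose F w := TVc c (bm_with_drift B mu ^~ w) (S w).
have good : {ae P, forall w, [/\ (u w k)%:E @[k --> \oo] --> F w,
    forall k, ((u w k)%:E <= F w)%E & forall k, 0 <= u w k]}.
  apply: filterS2 (bm_continuous_paths BM) (ae_nonneg_exponential SL) => w cB s0.
  split.
  - exact: (gridpush_cvg c0 (drift_continuous (mu := mu) cB) s0).
  - move=> k; have hk : 0 < mesh k :> R := mesh_gt0 k.
    apply: gridpush_le_TVc => //; rewrite -ler_pdivlMr//.
    by rewrite Num.Theory.truncn_le divr_ge0// ltW.
  - by move=> k; exact: gridpush_ge0.
split.
  rewrite -(potential_first mu c0 nu0).
  apply: (integral_stopped_limit BM c0 nu0 p0 q0 rp rq SL SI (lexx 0) ler01).
  apply: filterS good => w [cu ul _].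
  have mE k : moment 0 1 (stopped_push B S mu c (mesh k) w) = u w k.
    by rewrite /moment mul0r add0r mul1r.
  split=> [|k]; last by rewrite mE; exact: ul.
  by rewrite (_ : (fun k => _) = fun k => (u w k)%:E)//; apply/funext => k; rewrite mE.
rewrite -(potential_second mu c0 nu0).
apply: (integral_stopped_limit BM c0 nu0 p0 q0 rp rq SL SI ler01 (lexx 0)).
apply: filterS good => w [cu ul u0].
have mE k : (moment 1 0 (stopped_push B S mu c (mesh k) w))%:E =
    ((u w k)%:E * (u w k)%:E)%E.
  by rewrite /moment mul1r mul0r addr0 -EFinM expr2.
have F0 : (0 <= F w)%E by apply: le_trans (ul 0%N); rewrite lee_fin.
split=> [|k].
  rewrite (_ : (fun k => _) = fun k => ((u w k)%:E * (u w k)%:E)%E); last first.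
    by apply/funext => k; exact: mE.
  rewrite expe2; apply: cvgeM => //.
  rewrite -/(F w); case: (F w) F0 => [r _| _|//]; first by apply: mule_def_fin.
  by rewrite /mule_def /=.
rewrite mE expe2; apply: lee_pmul; rewrite ?lee_fin//; exact: ul.
Qed.
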